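(* There is a dual equivalence between the category $\mathbf{LKHaus}$ of locally compact Hausdorff spaces (the full subcategory of the category of completely regular spaces and continuous maps consisting of the locally compact spaces) and the category $\mathbf{lcbasic}$ of locally compact maximal basic extensions.
   Context: Completely regular spaces are Hausdorff. An $\ell$-ring is a ring $A$ with $1$ and a partial order $\le$ making $A$ a lattice, such that $a\le b$ implies $a+c\le b+c$, and $0\le a,b$ implies $0\le ab$. It is bounded if for each $a$ there is $n\in\mathbb N$ with $a\le n\cdot 1$; archimedean if $na\le b$ for all $n\in\mathbb N$ implies $a\le 0$; an $\ell$-algebra if it is an $\mathbb R$-algebra and $0\le a\in A$, $0\le r\in\mathbb R$ imply $0\le ra$. Let $\mathbf{bal}$ be the category of bounded archimedean $\ell$-algebras and unital $\ell$-algebra homomorphisms. Real numbers $r$ are identified with $r\cdot 1$, and $|a|=a\vee(-a)$. $B\in\mathbf{bal}$ is Dedekind complete if each (nonempty) subset bounded above has a least upper bound. A basic algebra is a Dedekind complete $B\in\mathbf{bal}$ whose boolean algebra of idempotents is atomic. A unital $\ell$-algebra homomorphism between Dedekind complete algebras is normal if it preserves all existing joins (hence all existing meets). A basic extension is a monomorphism $\alpha:A\to B$ in $\mathbf{bal}$, with $B$ a basic algebra, such that each element of $B$ is a join of meets of elements of $\alpha[A]$. The category $\mathbf{basic}$ has basic extensions as objects; a morphism from $\alpha:A\to B$ to $\alpha':A'\to B'$ is a pair $(\rho,\sigma)$ of morphisms $\rho:A\to A'$, $\sigma:B\to B'$ in $\mathbf{bal}$ with $\sigma$ normal and $\sigma\circ\alpha=\alpha'\circ\rho$;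 composition is componentwise. An $\ell$-ideal of $A\in\mathbf{bal}$ is an ideal $I$ such that $|a|\le|b|$ and $b\in I$ imply $a\in I$. $Y_A$ is the compact Hausdorff space of maximal $\ell$-ideals of $A$, with closed sets $\{M\in Y_A: I\subseteq M\}$, $I$ an $\ell$-ideal; $X_A$ is the set of isolated points of $Y_A$. For a basic extension $\alpha:A\to B$ let $\alpha_\flat:X_B\to Y_A$, $\alpha_\flat(M)=\alpha^{-1}(M)$, and let $\tau_\alpha$ be the least topology on $X_B$ making $\alpha_\flat$ continuous. Basic extensions $\alpha:A\to B$ and $\gamma:C\to B$ are compatible if $\tau_\alpha=\tau_\gamma$. A basic extension $\alpha:A\to B$ is maximal if for every compatible basic extension $\gamma:C\to B$ there is a morphism $\delta:C\to A$ in $\mathbf{bal}$ with $\alpha\circ\delta=\gamma$. An element $a\in A$ is $\alpha$-compact if for every real $\varepsilon>0$ and every subset $T$ of nonnegative elements of $A$, $|\alpha(a)|+\varepsilon\le\bigvee\alpha[T]$ (join presupposed to exist in $B$) implies that there is a finite subset $T'$ of $T$ with $|\alpha(a)|\le\bigvee\alpha[T']$; $I_\alpha=\{a\in A\mid a\text{ is }\alpha\text{-compact}\}$. A basic extension $\alpha:A\to B$ is locally compact if $\alpha(b)=\bigvee\{\alpha(a)\mid a\in I_\alpha, a\le b\}$ for all $0\le b\in A$. $\mathbf{lcbasic}$ is the full subcategory of $\mathbf{basic}$ consisting of the basic extensions that are both maximal and locally compact. *)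

(* Defs.v *)
From HB Require Import structures.
From mathcomp Require Import all_boot all_order all_algebra.
From mathcomp Require Import all_classical all_reals all_analysis.

Set Implicit Arguments.
Unset Strict Implicit.
Unset Printing Implicit Defensive.

Import Order.TTheory GRing.Theory Num.Theory.

Local Open Scope classical_set_scope.
Local Open Scope ring_scope.

Record category := Category {
  cobj :> Type;
  chom : cobj -> cobj -> Type;
  cidm : forall x, chom x x;
  ccomp : forall x y z, chom y z -> chom x y -> chom x z;
  ccompA : forall x y z t (h : chom z t) (g : chom y z) (f : chom x y),
    ccomp h (ccomp g f) = ccomp (ccomp h g) f;
  ccomp1l : forall x y (f : chom x y), ccomp (cidm y) f = f;
  ccomp1r : forall x y (f : chom x y), ccomp f (cidm x) = f
}.

Arguments cidm {c} x.

Definition opposite (C : category) : category := {|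
  cobj := C;
  chom x y := chom y x;
  cidm x := cidm x;
  ccomp x y z g f := ccomp f g;
  ccompA x y z t h g f := esym (ccompA f g h);
  ccomp1l x y f := ccomp1r f;
  ccomp1r x y f := ccomp1l f
|}.

Definition full_subcategory (C : category) (P : C -> Prop) : category := {|
  cobj := {x : C | P x};
  chom x y := chom (sval x) (sval y);
  cidm x := cidm (sval x);
  ccomp x y z g f := ccomp g f;
  ccompA x y z t h g f := ccompA h g f;
  ccomp1l x y f := ccomp1l f;
  ccomp1r x y f := ccomp1r f
|}.

Definition monomorphism (C : category) (x y : C) (f : chom x y) : Prop :=
  forall (z : C) (g h : chom z x), ccomp f g = ccomp f h -> g = h.

Definition isomorphism (C : category) (x y : C) (f : chom x y) : Prop :=
  exists g : chom y x, ccomp g f = cidm x /\ ccomp f g = cidm y.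

Record cfunctor (C D : category) := CFunctor {
  fobj :> C -> D;
  fhom : forall x y, chom x y -> chom (fobj x) (fobj y);
  fhom_id : forall x, fhom (cidm x) = cidm (fobj x);
  fhom_comp : forall x y z (g : chom y z) (f : chom x y),
    fhom (ccomp g f) = ccomp (fhom g) (fhom f)
}.

Definition functor_id (C : category) : cfunctor C C := {|
  fobj := id;
  fhom x y f := f;
  fhom_id x := erefl;
  fhom_comp x y z g f := erefl
|}.

Section FunctorComp.
Variables (C D E : category) (G : cfunctor D E) (F : cfunctor C D).

Lemma functor_comp_id (x : C) : fhom G (fhom F (cidm x)) = cidm (G (F x)).
Proof. by rewrite !fhom_id. Qed.

Lemma functor_comp_comp (x y z : C) (g : chom y z) (f : chom x y) :
  fhom G (fhom F (ccomp g f)) =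
  ccomp (fhom G (fhom F g)) (fhom G (fhom F f)).
Proof. by rewrite !fhom_comp. Qed.

Definition functor_comp : cfunctor C E := {|
  fobj x := G (F x);
  fhom x y f := fhom G (fhom F f);
  fhom_id := functor_comp_id;
  fhom_comp := functor_comp_comp
|}.

End FunctorComp.

Definition naturally_isomorphic (C D : category) (F G : cfunctor C D) : Prop :=
  exists eta : forall x, chom (F x) (G x),
    (forall x, isomorphism (eta x)) /\
    (forall x y (f : chom x y),
       ccomp (eta y) (fhom F f) = ccomp (fhom G f) (eta x)).

Definition equivalent (C D : category) : Prop :=
  exists (F : cfunctor C D) (G : cfunctor D C),
    naturally_isomorphic (functor_comp G F) (functor_id C) /\
    naturally_isomorphic (functor_comp F G) (functor_id D).

Definition dually_equivalent (C D : category) : Prop :=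
  equivalent (opposite C) D.

Record creg_space := CRegSpace {
  creg_sort :> topologicalType;
  creg_hausdorff : hausdorff_space creg_sort;
  creg_completely_regular : completely_regular_space creg_sort
}.

Lemma cts_compA (X Y Z T : topologicalType) (h : continuousType Z T)
    (g : continuousType Y Z) (f : continuousType X Y) :
  h \o (g \o f) = (h \o g) \o f :> continuousType X T.
Proof. exact/continuousEP. Qed.

Lemma cts_comp1l (X Y : topologicalType) (f : continuousType X Y) :
  idfun \o f = f :> continuousType X Y.
Proof. exact/continuousEP. Qed.

Lemma cts_comp1r (X Y : topologicalType) (f : continuousType X Y) :
  f \o idfun = f :> continuousType X Y.
Proof. exact/continuousEP. Qed.

Definition CReg : category := {|
  cobj := creg_space;
  chom X Y := continuousType X Y;
  cidm X := idfun : continuousType X X;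
  ccomp X Y Z g f := g \o f : continuousType X Z;
  ccompA X Y Z T h g f := cts_compA h g f;
  ccomp1l X Y f := cts_comp1l f;
  ccomp1r X Y f := cts_comp1r f
|}.

Definition LKHaus : category :=
  full_subcategory (fun X : CReg => locally_compact [set: (X : creg_space)]).

(* These are plain records rather than Hierarchy Builder structures: the join
   of a ring and a lattice structure cannot be declared below the library's
   [realDomainType].  The ring is a [pzRingType], so that [1 = 0] is allowed. *)
Record lring := LRing {
  lring_sort :> Type;
  lring_PzRing : GRing.PzRing lring_sort;
  lring_le : rel lring_sort;
  lring_meet : lring_sort -> lring_sort -> lring_sort;
  lring_join : lring_sort -> lring_sort -> lring_sort;
  lring_lexx : reflexive lring_le;
  lring_le_anti : antisymmetric lring_le;
  lring_le_trans : transitive lring_le;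
  lring_lexI : forall a b c,
    lring_le a (lring_meet b c) = lring_le a b && lring_le a c;
  lring_leUx : forall a b c,
    lring_le (lring_join a b) c = lring_le a c && lring_le b c;
  lring_lerD2r :
    let A : pzRingType := GRing.PzRing.Pack lring_PzRing in
    forall a b c : A, lring_le a b -> lring_le (a + c) (b + c);
  lring_mulr_ge0 :
    let A : pzRingType := GRing.PzRing.Pack lring_PzRing in
    forall a b : A, lring_le (0 : A) a -> lring_le (0 : A) b ->
      lring_le (0 : A) (a * b)
}.

HB.instance Definition _ (A : lring) : GRing.PzRing (lring_sort A) :=
  lring_PzRing A.
HB.instance Definition _ (A : lring) :=
  Order.Le_isPOrder.Build ring_display (lring_sort A)
    (@lring_lexx A) (@lring_le_anti A) (@lring_le_trans A).
HB.instance Definition _ (A : lring) :=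
  Order.POrder_MeetJoin_isLattice.Build ring_display (lring_sort A)
    (@lring_lexI A) (@lring_leUx A).

Record lalgebra (R : realType) := LAlgebra {
  lalgebra_lring :> lring;
  lalgebra_scale : R -> lalgebra_lring -> lalgebra_lring;
  lalgebra_scalerA : forall (r s : R) a,
    lalgebra_scale r (lalgebra_scale s a) = lalgebra_scale (r * s) a;
  lalgebra_scale1r : left_id 1 lalgebra_scale;
  lalgebra_scalerDr : right_distributive lalgebra_scale +%R;
  lalgebra_scalerDl : forall a,
    {morph (fun r : R => lalgebra_scale r a) : r s / r + s};
  lalgebra_scalerAl : forall (r : R) (a b : lalgebra_lring),
    lalgebra_scale r (a * b) = lalgebra_scale r a * b;
  lalgebra_scalerAr : forall (r : R) (a b : lalgebra_lring),
    lalgebra_scale r (a * b) = a * lalgebra_scale r b;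
  lalgebra_scale_ge0 : forall (r : R) (a : lalgebra_lring),
    0 <= r -> 0 <= a -> 0 <= lalgebra_scale r a
}.

HB.instance Definition _ (R : realType) (A : lalgebra R) :=
  GRing.Zmodule_isLmodule.Build R (lring_sort (lalgebra_lring A))
    (@lalgebra_scalerA R A) (@lalgebra_scale1r R A)
    (@lalgebra_scalerDr R A) (@lalgebra_scalerDl R A).

Record balType (R : realType) := Bal {
  bal_lalgebra :> lalgebra R;
  bal_bounded : forall a : bal_lalgebra, exists n : nat, a <= n%:R;
  bal_archimedean : forall a b : bal_lalgebra,
    (forall n : nat, a *+ n <= b) -> a <= 0
}.

Definition labs (A : lring) (a : A) : A := Order.join a (- a).

Definition is_bal_hom (R : realType) (A B : balType R) (f : A -> B) : Prop :=
  [/\ linear f, monoid_morphism f,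
      {morph f : x y / Order.meet x y} & {morph f : x y / Order.join x y}].

Record bal_hom (R : realType) (A B : balType R) := BalHom {
  bal_fun :> A -> B;
  bal_homP : is_bal_hom bal_fun
}.

Section BalCategory.
Variable R : realType.
Implicit Types A B C D : balType R.

Lemma bal_hom_eq A B (f g : bal_hom A B) : f =1 g -> f = g.
Proof.
case: f g => [f fP] [g gP] /= /funext fg.
by subst g; congr BalHom; exact: Prop_irrelevance.
Qed.

Lemma is_bal_hom_id A : is_bal_hom (@id A).
Proof. by split. Qed.

Lemma is_bal_hom_comp A B C (g : bal_hom B C) (f : bal_hom A B) :
  is_bal_hom (g \o f).
Proof.
case: (bal_homP g) (bal_homP f) => [gl [g1 gM] gI gU] [fl [f1 fM] fI fU].
split => [r x y||x y|x y] /=; first by rewrite fl gl.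
- by split => [|x y] /=; [rewrite f1 g1|rewrite fM gM].
- by rewrite fI gI.
- by rewrite fU gU.
Qed.

Definition bal_id A : bal_hom A A := BalHom (is_bal_hom_id A).

Definition bal_comp A B C (g : bal_hom B C) (f : bal_hom A B) : bal_hom A C :=
  BalHom (is_bal_hom_comp g f).

Lemma bal_compA A B C D (h : bal_hom C D) (g : bal_hom B C) (f : bal_hom A B) :
  bal_comp h (bal_comp g f) = bal_comp (bal_comp h g) f.
Proof. exact: bal_hom_eq. Qed.

Lemma bal_comp1l A B (f : bal_hom A B) : bal_comp (bal_id B) f = f.
Proof. exact: bal_hom_eq. Qed.

Lemma bal_comp1r A B (f : bal_hom A B) : bal_comp f (bal_id A) = f.
Proof. exact: bal_hom_eq. Qed.

Definition bal : category := {|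
  cobj := balType R;
  chom := @bal_hom R;
  cidm := bal_id;
  ccomp := bal_comp;
  ccompA := bal_compA;
  ccomp1l := bal_comp1l;
  ccomp1r := bal_comp1r
|}.

End BalCategory.

Definition l_ideal (A : lring) (I : set A) : Prop :=
  [/\ I 0, forall a b, I a -> I b -> I (a + b),
      forall c a, I a -> I (c * a) /\ I (a * c) &
      forall a b, labs a <= labs b -> I b -> I a].

Definition maximal_l_ideal (A : lring) (M : set A) : Prop :=
  [/\ l_ideal M, M <> setT &
      forall J, l_ideal J -> M `<=` J -> J = M \/ J = setT].

Section LRingTheory.
Variable A : lring.
Implicit Types a b c d : A.

Lemma l_leD2r a b c : a <= b -> a + c <= b + c.
Proof. exact: lring_lerD2r. Qed.

Lemma l_mulr_ge0 a b : 0 <= a -> 0 <= b -> 0 <= a * b.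
Proof. exact: lring_mulr_ge0. Qed.

Lemma l_leD a b c d : a <= b -> c <= d -> a + c <= b + d.
Proof.
move=> ab cd; apply: le_trans (l_leD2r c ab) _.
by rewrite ![b + _]addrC; exact: l_leD2r.
Qed.

Lemma l_subr_ge0 a b : (0 <= b - a) = (a <= b).
Proof.
apply/idP/idP => [/(l_leD2r a)|/(l_leD2r (- a))].
  by rewrite add0r subrK.
by rewrite subrr.
Qed.

Lemma l_leN a b : (- b <= - a) = (a <= b).
Proof. by rewrite -(l_subr_ge0 (- b)) opprK addrC l_subr_ge0. Qed.

Lemma l_joinD a b c : Order.join a b + c = Order.join (a + c) (b + c).
Proof.
apply/le_anti/andP; split; last first.
  by rewrite leUx !l_leD2r // (leUl, leUr).
rewrite -[leRHS](subrK c); apply: l_leD2r; rewrite leUx.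
by apply/andP; split; rewrite -[leLHS](addrK c); apply: l_leD2r;
  rewrite (leUl, leUr).
Qed.

Lemma l_meetD a b c : Order.meet a b + c = Order.meet (a + c) (b + c).
Proof.
apply/le_anti/andP; split.
  by rewrite lexI !l_leD2r // (leIl, leIr).
rewrite -[leLHS](subrK c); apply: l_leD2r; rewrite lexI.
by apply/andP; split; rewrite -[leRHS](addrK c); apply: l_leD2r;
  rewrite (leIl, leIr).
Qed.

Lemma l_oppI a b : - Order.meet a b = Order.join (- a) (- b).
Proof.
apply/le_anti/andP; split; last by rewrite leUx !l_leN leIl leIr.
rewrite -l_leN opprK lexI.
by apply/andP; split; rewrite -[leRHS]opprK l_leN (leUl, leUr).
Qed.

Lemma l_meet_pos_neg a : Order.meet (Order.join a 0) (Order.join (- a) 0) = 0.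
Proof.
set q := Order.join (- a) 0.
have -> : Order.join a 0 = a + q.
  by rewrite addrC l_joinD addNr add0r joinC.
rewrite -{2}[q]add0r -l_meetD -[Order.meet a 0]opprK l_oppI oppr0.
by rewrite addNr.
Qed.

Lemma l_abs_le a b : (labs a <= b) = (a <= b) && (- a <= b).
Proof. exact: leUx. Qed.

Lemma l_le_abs a : a <= labs a. Proof. exact: leUl. Qed.

Lemma l_leN_abs a : - a <= labs a. Proof. exact: leUr. Qed.

Lemma l_absD a b : labs (a + b) <= labs a + labs b.
Proof.
rewrite l_abs_le opprD.
by rewrite !l_leD // ?l_le_abs ?l_leN_abs.
Qed.

Lemma l_abs_id a : 0 <= a -> labs a = a.
Proof.
move=> a0; apply: join_l; apply: le_trans (a0).
by rewrite -oppr0 l_leN.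
Qed.

End LRingTheory.

Section LAlgebraTheory.
Variables (R : realType) (A : lalgebra R).
Implicit Types (a b c : A) (r s : R).

Lemma l_scale_ge0 r a : 0 <= r -> 0 <= a -> 0 <= r *: a.
Proof. exact: lalgebra_scale_ge0. Qed.

Lemma l_scalerAl r a b : r *: (a * b) = (r *: a) * b.
Proof. exact: lalgebra_scalerAl. Qed.

Lemma l_scalerAr r a b : r *: (a * b) = a * (r *: b).
Proof. exact: lalgebra_scalerAr. Qed.

Lemma l_ler_wpZ2 r a b : 0 <= r -> a <= b -> r *: a <= r *: b.
Proof.
move=> r0 ab; rewrite -l_subr_ge0 -scalerBr; apply: l_scale_ge0 => //.
by rewrite l_subr_ge0.
Qed.

Lemma l_ler_wpZ r s a : 0 <= a -> r <= s -> r *: a <= s *: a.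
Proof.
move=> a0 rs; rewrite -l_subr_ge0 -scalerBl; apply: l_scale_ge0 => //.
by rewrite subr_ge0.
Qed.

Lemma l_abs_ge0 a : 0 <= labs a.
Proof.
have -> : labs a = 2^-1 *: (labs a + labs a).
  by rewrite -mulr2n -[labs a *+ 2]scaler_nat scalerA mulVf ?scale1r // pnatr_eq0.
apply: l_scale_ge0; first by rewrite invr_ge0.
by rewrite -(subrr a) l_leD // (l_le_abs, l_leN_abs).
Qed.

Lemma l_abs_abs a : labs (labs a) = labs a.
Proof. exact/l_abs_id/l_abs_ge0. Qed.

Lemma l_absZ r a : 0 <= r -> labs (r *: a) <= r *: labs a.
Proof.
move=> r0; rewrite l_abs_le -scalerN.
by rewrite !l_ler_wpZ2 // (l_le_abs, l_leN_abs).
Qed.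

Lemma l_meetZ r a b : 0 < r ->
  r *: Order.meet a b = Order.meet (r *: a) (r *: b).
Proof.
move=> r0; have r0' := ltW r0; have rV0 : 0 <= r^-1 by rewrite invr_ge0.
have rK c : c = r^-1 *: (r *: c).
  by rewrite scalerA mulVf ?scale1r // lt0r_neq0.
apply/le_anti/andP; split.
  by rewrite lexI !l_ler_wpZ2 // (leIl, leIr).
have -> : Order.meet (r *: a) (r *: b) =
    r *: (r^-1 *: Order.meet (r *: a) (r *: b)).
  by rewrite scalerA mulfV ?scale1r // lt0r_neq0.
apply: l_ler_wpZ2; rewrite // lexI {2}(rK a) {3}(rK b).
by rewrite !l_ler_wpZ2 // (leIl, leIr).
Qed.

Lemma l_ideal_abs (I : set A) a : l_ideal I -> I a -> I (labs a).
Proof. by case=> _ _ _ Is; apply: Is; rewrite l_abs_abs. Qed.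

Lemma l_ideal_le (I : set A) a b : l_ideal I -> 0 <= a -> a <= b -> I b -> I a.
Proof.
by case=> _ _ _ Is a0 ab; apply: Is; rewrite !l_abs_id // (le_trans a0).
Qed.

Lemma l_idealZ (I : set A) r a : l_ideal I -> I a -> I (r *: a).
Proof.
case=> _ _ IM _ Ia; rewrite -[a]mul1r l_scalerAl.
by have [] := IM (r *: (1 : A) : A) a Ia.
Qed.

Lemma l_ideal1 (I : set A) : l_ideal I -> I 1 -> I = setT.
Proof.
case=> _ _ IM _ I1; apply/seteqP; split=> // a _.
by rewrite -[a]mul1r; case: (IM a 1).
Qed.

Lemma l_idealI (I J : set A) : l_ideal I -> l_ideal J -> l_ideal (I `&` J).
Proof.
move=> [I0 ID IM Is] [J0 JD JM Js]; split=> //.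
- by move=> a b [Ia Ja] [Ib Jb]; split; [exact: ID|exact: JD].
- move=> c a [Ia Ja]; have [? ?] := IM c a Ia; have [? ?] := JM c a Ja.
  by split.
- by move=> a b ab [Ib Jb]; split; [exact: Is Ib|exact: Js Jb].
Qed.

End LAlgebraTheory.

Section BalTheory.
Variables (R : realType) (A : balType R).
Implicit Types (a b c x : A) (r s : R) (M : set A).

Local Notation one := (1 : A).

Lemma bal_le_scale1 a : exists2 k : R, 0 <= k & a <= k *: one.
Proof.
by have [n an] := bal_bounded a; exists n%:R; rewrite ?ler0n // scaler_nat.
Qed.

Lemma bal_ge01 : 0 <= 1 :> A.
Proof.
have [n] := bal_bounded (labs 1 : A); rewrite -scaler_nat => le1n.
have := le_trans (l_abs_ge0 (1 : A)) le1n.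
case: n le1n => [|n] le1n le0n.
  move: le1n; rewrite scale0r l_abs_le => /andP[_].
  by rewrite -{1}oppr0 l_leN.
rewrite -[1]scale1r -(@mulVf R n.+1%:R) ?pnatr_eq0 // -scalerA.
by apply: l_scale_ge0.
Qed.

Lemma bal_absM c x : exists k : R, [/\ 0 <= k,
  labs (c * x) <= k *: labs x & labs (x * c) <= k *: labs x].
Proof.
have [k k0 ck] := bal_le_scale1 (labs c).
have [ck1 ck2] : c <= k *: one /\ - c <= k *: one.
  by apply/andP; rewrite -l_abs_le.
set p := Order.join x 0; set q := Order.join (- x) 0.
have p0 : 0 <= p by rewrite leUr.
have q0 : 0 <= q by rewrite leUr.
have px : p <= labs x by rewrite leUx l_le_abs l_abs_ge0.
have qx : q <= labs x by rewrite leUx l_leN_abs l_abs_ge0.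
have xE : x = p - q.
  have <- : q + x = p by rewrite l_joinD addNr add0r joinC.
  by rewrite addrAC subrr add0r.
have bnd y : 0 <= y -> y <= labs x -> forall d, d <= k *: one ->
    d * y <= k *: labs x /\ y * d <= k *: labs x.
  move=> y0 yx d dk; have yk : k *: y <= k *: labs x by exact: l_ler_wpZ2.
  split; apply: le_trans yk; rewrite -l_subr_ge0.
    rewrite -{1}[y]mul1r l_scalerAl -mulrBl.
    by apply: l_mulr_ge0 => //; rewrite l_subr_ge0.
  rewrite -{1}[y]mulr1 l_scalerAr -mulrBr.
  by apply: l_mulr_ge0 => //; rewrite l_subr_ge0.
exists (k + k); split; first exact: addr_ge0.
  rewrite {1}xE l_abs_le mulrBr opprB [c * q - _]addrC scalerDl.
  have [? _] := bnd _ p0 px _ ck1; have [? _] := bnd _ q0 qx _ ck1.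
  have [? _] := bnd _ p0 px _ ck2; have [? _] := bnd _ q0 qx _ ck2.
  by rewrite -!mulNr !l_leD.
rewrite {1}xE l_abs_le mulrBl opprB [q * c - _]addrC scalerDl.
have [_ ?] := bnd _ p0 px _ ck1; have [_ ?] := bnd _ q0 qx _ ck1.
have [_ ?] := bnd _ p0 px _ ck2; have [_ ?] := bnd _ q0 qx _ ck2.
by rewrite -!mulrN !l_leD.
Qed.

Definition l_ideal_adjoin M x : set A :=
  [set b | exists m r, [/\ M m, 0 <= r & labs b <= m + r *: labs x]].

Lemma l_ideal_adjoinP M x : l_ideal M -> l_ideal (l_ideal_adjoin M x).
Proof.
move=> Mi; have [M0 MD MM Ms] := Mi; split.
- exists 0, 0; split=> //.
  by rewrite scale0r addr0 l_abs_id.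
- move=> a b [m [r [Mm r0 am]]] [m' [r' [Mm' r0' bm]]].
  exists (m + m'), (r + r'); split; [exact: MD|exact: addr_ge0|].
  apply: le_trans (l_absD a b) _; rewrite scalerDl addrACA.
  exact: l_leD.
- move=> c a [m [r [Mm r0 am]]].
  have [k [k0 ck kc]] := bal_absM c a.
  have kM : M (k *: m) by exact: l_idealZ.
  have H : k *: labs a <= k *: m + (k * r) *: labs x.
    by rewrite -scalerA -scalerDr; exact: l_ler_wpZ2.
  by split; exists (k *: m), (k * r); split=> //; rewrite ?mulr_ge0 //;
     apply: le_trans H.
- move=> a b ab [m [r [Mm r0 bm]]]; exists m, r; split=> //.
  exact: le_trans bm.
Qed.

Section Maximal.
Variables (M : set A) (maxM : maximal_l_ideal M).
Let Mi : l_ideal M. Proof. by case: maxM. Qed.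

Lemma max_notin1 : ~ M 1.
Proof. by case: maxM => _ MT _ /(l_ideal1 Mi). Qed.

Lemma max_notin_scale1 r m : 0 < r -> r *: one <= m -> ~ M m.
Proof.
move=> r0 rm Mm; apply: max_notin1.
have -> : 1 = r^-1 *: (r *: one) :> A.
  by rewrite scalerA mulVf ?scale1r // lt0r_neq0.
apply: l_idealZ => //; apply: l_ideal_le rm Mm => //.
by apply: l_scale_ge0; [exact: ltW|exact: bal_ge01].
Qed.

Lemma max_adjoin x : ~ M x ->
  exists m r, [/\ M m, 0 <= m, 0 < r & one <= m + r *: labs x].
Proof.
move=> nMx; have [M0 _ _ _] := Mi.
have Ji := l_ideal_adjoinP x Mi.
have MJ : M `<=` l_ideal_adjoin M x.
  move=> m Mm; exists (labs m), 0; split=> //; first exact: l_ideal_abs.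
  by rewrite scale0r addr0.
have Jx : l_ideal_adjoin M x x.
  by exists 0, 1; split=> //; rewrite scale1r add0r.
case: maxM => _ _ /(_ _ Ji MJ) [JM|JT].
  by move: Jx; rewrite JM.
have [m [r [Mm r0]]] : l_ideal_adjoin M x 1 by rewrite JT.
rewrite l_abs_id ?bal_ge01 // => H.
exists (labs m), (r + 1); split; [exact: l_ideal_abs|exact: l_abs_ge0| |].
  by rewrite ltr_wpDl.
apply: le_trans H _; apply: l_leD; first exact: l_le_abs.
by apply: l_ler_wpZ; [exact: l_abs_ge0|rewrite lerDl].
Qed.

Lemma max_prime a b : 0 <= a -> 0 <= b -> M (Order.meet a b) -> M a \/ M b.
Proof.
move=> a0 b0 Mab; apply: contrapT => /not_orP [nMa nMb].
have [m [r [Mm m0 r0 H]]] := max_adjoin nMa.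
have [m' [r' [Mm' m0' r0' H']]] := max_adjoin nMb.
rewrite l_abs_id // in H; rewrite l_abs_id // in H'.
have [_ MD _ _] := Mi.
set t := r + r'; have t0 : 0 < t by rewrite addr_gt0.
apply: (@max_notin_scale1 1 (t *: Order.meet a b + (m + m'))) => //; last first.
  by apply: (MD); [exact: l_idealZ|exact: MD].
rewrite scale1r l_meetZ // l_meetD lexI; apply/andP; split.
  apply: le_trans H _; rewrite addrC; apply: l_leD.
    by apply: l_ler_wpZ => //; rewrite lerDl ltW.
  by rewrite -[leLHS]addr0 l_leD.
apply: le_trans H' _; rewrite addrC; apply: l_leD.
  by apply: l_ler_wpZ => //; rewrite lerDr ltW.
by rewrite -[leLHS]add0r l_leD.
Qed.

Lemma max_primeI (I J : set A) : l_ideal I -> l_ideal J ->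
  (I `&` J `<=` M) -> I `<=` M \/ J `<=` M.
Proof.
move=> Ii Ji IJM; apply: contrapT => /not_orP[].
move=> /existsNP[a /not_implyP[Ia nMa]] /existsNP[b /not_implyP[Jb nMb]].
have absM (c : A) : M (labs c) -> M c.
  by case: Mi => _ _ _ Ms; apply: Ms; rewrite l_abs_abs.
have ab0 : 0 <= Order.meet (labs a) (labs b) by rewrite lexI !l_abs_ge0.
have : M (Order.meet (labs a) (labs b)).
  apply: IJM; split.
    by apply: (l_ideal_le Ii ab0 (leIl _ _)); exact: l_ideal_abs.
  by apply: (l_ideal_le Ji ab0 (leIr _ _)); exact: l_ideal_abs.
by case/(max_prime (l_abs_ge0 a) (l_abs_ge0 b)) => /absM.
Qed.

Lemma max_residue a : exists r : R, M (a - r *: one).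
Proof.
have [M0 MD _ Ms] := Mi.
have ge1 := bal_ge01.
pose S := [set s : R | M (Order.join (a - s *: one) 0)].
have [k k0 ak] := bal_le_scale1 (labs a).
have Sk : S k.
  rewrite /S /=; have -> : Order.join (a - k *: one) 0 = 0; last by [].
  apply: join_r; rewrite -[leRHS](subrr (k *: one)); apply: l_leD2r.
  exact: le_trans (l_le_abs a) ak.
have lbS : lbound S (- k).
  move=> s Ss; rewrite leNgt; apply/negP => sk.
  apply: (@max_notin_scale1 (- k - s) _ _ _ Ss); first by rewrite subr_gt0.
  apply: le_trans (leUl _ _); rewrite scalerBl; apply: l_leD2r.
  by rewrite scaleNr -[leRHS]opprK l_leN; exact: le_trans (l_leN_abs a) ak.
have infS : has_inf S by split; [exists k|exists (- k)].
exists (inf S); set r := inf S.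
have approx (e : R) : 0 < e ->
    exists2 m, M m & labs (a - r *: one) <= m + e *: one.
  move=> e0.
  have [s Ss sr] := inf_adherent e0 infS.
  have nS : ~ S (r - e).
    move=> Sre; have := inf_lbound (ex_intro _ _ lbS) Sre.
    by rewrite -/r leNgt => /negP; apply; rewrite ltrBlDr ltrDl.
  have := l_meet_pos_neg (a - (r - e) *: one) => pn0.
  have : M (Order.meet (Order.join (a - (r - e) *: one) 0)
                       (Order.join (- (a - (r - e) *: one)) 0)).
    by rewrite pn0.
  move=> /(max_prime (leUr _ _) (leUr _ _)) [//|Mn].
  pose m1 : A := Order.join (a - s *: one) 0.
  pose m2 : A := Order.join (- (a - (r - e) *: one)) 0.
  exists (m1 + m2); first exact: MD.
  have m10 : 0 <= m1 by exact: leUr.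
  have m20 : 0 <= m2 by exact: leUr.
  rewrite l_abs_le; apply/andP; split.
    apply: (@le_trans _ _ (m1 + e *: one)); last first.
      by apply: l_leD2r; rewrite -[leLHS]addr0 l_leD.
    have -> : a - r *: one = (a - s *: one) + (s - r) *: one.
      by rewrite scalerBl addrA subrK.
    apply: l_leD; first exact: leUl.
    by apply: l_ler_wpZ => //; rewrite lerBlDl ltW.
  apply: (@le_trans _ _ (m2 + e *: one)); last first.
    by apply: l_leD2r; rewrite -[leLHS]add0r l_leD.
  have -> : - (a - r *: one) = - (a - (r - e) *: one) + e *: one.
    by rewrite !opprB scalerBl addrAC subrK.
  by apply: l_leD2r; exact: leUl.
apply: contrapT => /max_adjoin [m [t [Mm m0 t0 H]]].
have [|m' Mm' H'] := approx (2^-1 / t); first by rewrite divr_gt0 ?invr_gt0.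
apply: (@max_notin_scale1 2^-1 (m + t *: m')); first by rewrite invr_gt0.
  have E : 2^-1 *: one + 2^-1 *: one = 1.
    rewrite -scalerDl; have -> : 2^-1 + 2^-1 = 1 :> R.
      by rewrite [RHS]splitr mul1r.
    by rewrite scale1r.
  rewrite -[leLHS](addrK (2^-1 *: one)) E.
  rewrite -[leRHS](addrK (2^-1 *: one)); apply: l_leD2r.
  apply: le_trans H _; rewrite -addrA; apply: l_leD => //.
  apply: le_trans (l_ler_wpZ2 (ltW t0) H') _.
  by rewrite scalerDr scalerA mulrCA mulfV ?mulr1 // lt0r_neq0.
by apply: MD => //; exact: l_idealZ.
Qed.

End Maximal.

End BalTheory.

Record max_space (R : realType) (A : balType R) := MaxSpace {
  max_ideal :> set A;
  max_idealP : maximal_l_ideal max_ideal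
}.

Section MaxSpaceTopology.
Variables (R : realType) (A : balType R).

HB.instance Definition _ := gen_eqMixin (max_space A).
HB.instance Definition _ := gen_choiceMixin (max_space A).

Definition max_space_open : set (set (max_space A)) :=
  [set U | exists2 I : set A, l_ideal I &
     ~` U = [set M : max_space A | I `<=` M]].

Lemma max_space_openT : max_space_open setT.
Proof.
exists setT; first by split.
rewrite setCT; apply/seteqP; split=> // M TM.
by have [_ MT _] := max_idealP M; apply: MT; apply/seteqP; split.
Qed.

Lemma max_space_openI : setI_closed max_space_open.
Proof.
move=> U V [I Ii UE] [J Ji VE]; exists (I `&` J); first exact: l_idealI.
rewrite setCI UE VE; apply/seteqP; split=> M /=.
  by case=> [IM a [/IM]|JM a [_ /JM]].
exact: max_primeI (max_idealP M) _ _ Ii Ji.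
Qed.

Lemma max_space_open_bigU (T : Type) (U : T -> set (max_space A)) :
  (forall i, max_space_open (U i)) -> max_space_open (\bigcup_i U i).
Proof.
move=> Uo; have {Uo} /choice[I IP] i : exists I : set A, l_ideal I /\
    ~` U i = [set M : max_space A | I `<=` M].
  by have [I] := Uo i; exists I.
exists [set a | forall J : set A, l_ideal J -> (forall i, I i `<=` J) -> J a].
  split=> [J [] //|a b Ja Jb J Ji IJ|c a Ja|a b ab Jb J Ji IJ].
  - by have [_ JD _ _] := Ji; apply: JD; [exact: Ja|exact: Jb].
  - by split=> J Ji IJ; have [_ _ JM _] := Ji;
      have [] := JM c a (Ja J Ji IJ).
  - by have [_ _ _ Js] := Ji; apply: Js ab _; exact: Jb.
rewrite setC_bigcup; apply/seteqP; split=> M /=.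
  move=> MU a /(_ M); apply; first by case: (max_idealP M).
  by move=> i; have := MU i Logic.I; rewrite (IP i).2.
move=> IM i _; rewrite (IP i).2 => a Ia; apply: IM => J _ /(_ i); exact.
Qed.

HB.instance Definition _ := isOpenTopological.Build (max_space A)
  max_space_openT max_space_openI max_space_open_bigU.

Lemma max_space_closedP (C : set (max_space A)) : closed C <->
  exists2 I : set A, l_ideal I & C = [set M : max_space A | I `<=` M].
Proof. by rewrite -openC /open /= /max_space_open /= setCK. Qed.

End MaxSpaceTopology.

Section Contraction.
Variables (R : realType) (A B : balType R) (f : bal_hom A B).

Lemma bal_hom_labs a : f (labs a) = labs (f a).
Proof.
have [fl _ _ fU] := bal_homP f.
rewrite /labs fU; congr Order.join.
have := fl (-1) a 0; rewrite addr0 !scaleN1r => ->.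
have := fl 1 0 0; rewrite scaler0 addr0 scale1r => f00.
suff -> : f 0 = 0 by rewrite addr0.
by rewrite -[LHS](addrK (f 0)) -f00 subrr.
Qed.

Lemma maximal_l_ideal_preimage (M : set B) :
  maximal_l_ideal M -> maximal_l_ideal (f @^-1` M).
Proof.
move=> Mm; have [Mi _ _] := Mm; have [M0 MD MM Ms] := Mi.
have [fl [f1 fM] _ _] := bal_homP f.
have fD a b : f (a + b) = f a + f b.
  by rewrite -[a]scale1r fl !scale1r.
have f0 : f 0 = 0.
  by rewrite -[LHS](addrK (f 0)) -fD addr0 subrr.
have fZ (r : R) a : f (r *: a) = r *: f a.
  by rewrite -[r *: a]addr0 fl f0 addr0.
have fN a : f (- a) = - f a by rewrite -[- a]scaleN1r fZ scaleN1r.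
split.
- split=> /=; first by rewrite f0.
  + by move=> a b Ma Mb; rewrite fD; exact: MD.
  + by move=> c a Ma; rewrite !fM; exact: MM.
  + move=> a b ab; apply: Ms; rewrite -!bal_hom_labs.
    have [_ _ fI _] := bal_homP f.
    by rewrite leEmeet -fI; apply/eqP; congr (f _); exact/meet_l.
- move=> /seteqP[_ /(_ 1 Logic.I)] /=; rewrite f1.
  exact: max_notin1 Mm.
- move=> J Ji MJ; have [JM|] := pselect (J `<=` f @^-1` M); first by left; apply/seteqP.
  move=> /existsNP[a /not_implyP[Ja /= nMfa]]; right.
  have [r Mr] := max_residue Mm (f a).
  have [_ JD _ _] := Ji.
  have r0 : r != 0.
    by apply/eqP => r0; apply: nMfa; move: Mr; rewrite r0 scale0r subr0.
  apply: (l_ideal1 Ji).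
  have Jr : J (a - r *: (1 : A)).
    by apply: MJ; rewrite /= fD fN fZ f1.
  have {Jr} Jr : J (r *: (1 : A)).
    have -> : r *: (1 : A) = a + (-1) *: (a - r *: (1 : A)).
      by rewrite scaleN1r opprB addrCA subrr addr0.
    by apply: JD => //; exact: l_idealZ.
  have -> : 1 = r^-1 *: (r *: (1 : A)) by rewrite scalerA mulVf // scale1r.
  exact: l_idealZ.
Qed.

End Contraction.

Definition dedekind_complete (R : realType) (B : balType R) : Prop :=
  forall S : set B, S !=set0 -> has_ubound S -> exists b, supremums S b.

Definition idempotent_elt (A : lring) (e : A) : Prop := e * e = e.

(* [e * f = e] is the order of the boolean algebra of idempotents. *)
Definition idempotent_atom (A : lring) (e : A) : Prop :=
  [/\ idempotent_elt e, e <> 0 &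
      forall f, idempotent_elt f -> f * e = f -> f = 0 \/ f = e].

Definition atomic_idempotents (A : lring) : Prop :=
  forall f : A, idempotent_elt f -> f <> 0 ->
    exists2 e, idempotent_atom e & e * f = e.

Definition basic_algebra (R : realType) (B : balType R) : Prop :=
  dedekind_complete B /\ atomic_idempotents B.

Definition normal_hom (R : realType) (A B : balType R) (f : bal_hom A B) : Prop :=
  forall (S : set A) (a : A), supremums S a -> supremums (f @` S) (f a).

Definition join_meet_dense (R : realType) (A B : balType R)
    (alpha : bal_hom A B) : Prop :=
  forall b : B, exists2 S : set B,
    (forall m, S m -> exists2 T, T `<=` range alpha & infimums T m) &
    supremums S b.

Definition basic_extension (R : realType) (A B : balType R)
    (alpha : bal_hom A B) : Prop :=
  [/\ @monomorphism (bal R) A B alpha, basic_algebra B &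
      join_meet_dense alpha].

Section Compatible.
Variable R : realType.

Definition isolated_max (B : balType R) : Type :=
  set_type (isolated [set: max_space B]).

HB.instance Definition _ (B : balType R) := Choice.on (isolated_max B).

Definition flat (A B : balType R) (alpha : bal_hom A B) (M : isolated_max B) :
    max_space A :=
  MaxSpace (maximal_l_ideal_preimage alpha (max_idealP (set_val M))).

(* The least topology on the isolated points making [flat alpha] continuous. *)
Definition tau (A B : balType R) (alpha : bal_hom A B) :
    set (set (isolated_max B)) :=
  @open (initial_topology (flat alpha)).

Definition compatible (A C B : balType R) (alpha : bal_hom A B)
    (gamma : bal_hom C B) : Prop := tau alpha = tau gamma.

Definition maximal_extension (A B : balType R) (alpha : bal_hom A B) : Prop :=
  forall (C : balType R) (gamma : bal_hom C B),
    basic_extension gamma -> compatible alpha gamma ->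
    exists delta : bal_hom C A, bal_comp alpha delta = gamma.

Definition compact_element (A B : balType R) (alpha : bal_hom A B) (a : A) :
    Prop :=
  forall (eps : R) (T : set A) (s : B), 0 < eps ->
    (forall t, T t -> 0 <= t) -> supremums (alpha @` T) s ->
    labs (alpha a) + eps *: (1 : B) <= s ->
    exists (T' : set A) (s' : B), [/\ T' `<=` T, finite_set T',
      supremums (alpha @` T') s' & labs (alpha a) <= s'].

Definition compact_elements (A B : balType R) (alpha : bal_hom A B) : set A :=
  [set a | compact_element alpha a].

Definition locally_compact_extension (A B : balType R) (alpha : bal_hom A B) :
    Prop :=
  forall b : A, 0 <= b ->
    supremums (alpha @` [set a | compact_elements alpha a /\ a <= b]) (alpha b).

End Compatible.

Record basic_ext (R : realType) := BasicExt {
  ext_dom : balType R;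
  ext_cod : balType R;
  ext_hom :> bal_hom ext_dom ext_cod;
  ext_basic : basic_extension ext_hom
}.

Record basic_hom (R : realType) (alpha alpha' : basic_ext R) := BasicHom {
  basic_rho : bal_hom (ext_dom alpha) (ext_dom alpha');
  basic_sigma : bal_hom (ext_cod alpha) (ext_cod alpha');
  basic_normal : normal_hom basic_sigma;
  basic_square : bal_comp basic_sigma alpha = bal_comp alpha' basic_rho
}.

Section BasicCategory.
Variable R : realType.
Implicit Types alpha beta gamma delta : basic_ext R.

Lemma basic_hom_eq alpha beta (f g : basic_hom alpha beta) :
  basic_rho f = basic_rho g -> basic_sigma f = basic_sigma g -> f = g.
Proof.
case: f g => [r s n q] [r' s' n' q'] /= rr ss; subst r' s'.
by congr BasicHom; exact: Prop_irrelevance.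
Qed.

Lemma normal_id (B : balType R) : normal_hom (bal_id B).
Proof. by move=> S b; rewrite image_id. Qed.

Lemma normal_comp (B C D : balType R) (g : bal_hom C D) (f : bal_hom B C) :
  normal_hom g -> normal_hom f -> normal_hom (bal_comp g f).
Proof. by move=> gn fn S b /fn/gn; rewrite image_comp. Qed.

Lemma basic_id_square alpha :
  bal_comp (bal_id (ext_cod alpha)) alpha =
  bal_comp alpha (bal_id (ext_dom alpha)).
Proof. by rewrite bal_comp1l bal_comp1r. Qed.

Lemma basic_comp_square alpha beta gamma (g : basic_hom beta gamma)
    (f : basic_hom alpha beta) :
  bal_comp (bal_comp (basic_sigma g) (basic_sigma f)) alpha =
  bal_comp gamma (bal_comp (basic_rho g) (basic_rho f)).
Proof.
by rewrite -bal_compA basic_square bal_compA basic_square -bal_compA.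
Qed.

Definition basic_id alpha : basic_hom alpha alpha :=
  BasicHom (@normal_id _) (basic_id_square alpha).

Definition basic_comp alpha beta gamma (g : basic_hom beta gamma)
    (f : basic_hom alpha beta) : basic_hom alpha gamma :=
  BasicHom (normal_comp (@basic_normal _ _ _ g) (@basic_normal _ _ _ f))
    (basic_comp_square g f).

Lemma basic_compA alpha beta gamma delta (h : basic_hom gamma delta)
    (g : basic_hom beta gamma) (f : basic_hom alpha beta) :
  basic_comp h (basic_comp g f) = basic_comp (basic_comp h g) f.
Proof. by apply: basic_hom_eq; exact: bal_compA. Qed.

Lemma basic_comp1l alpha beta (f : basic_hom alpha beta) :
  basic_comp (basic_id beta) f = f.
Proof. by apply: basic_hom_eq; exact: bal_comp1l. Qed.

Lemma basic_comp1r alpha beta (f : basic_hom alpha beta) :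
  basic_comp f (basic_id alpha) = f.
Proof. by apply: basic_hom_eq; exact: bal_comp1r. Qed.

Definition basic : category := {|
  cobj := basic_ext R;
  chom := @basic_hom R;
  cidm := basic_id;
  ccomp := basic_comp;
  ccompA := basic_compA;
  ccomp1l := basic_comp1l;
  ccomp1r := basic_comp1r
|}.

Definition lcbasic : category :=
  full_subcategory (fun alpha : basic =>
    maximal_extension (alpha : basic_ext R) /\
    locally_compact_extension (alpha : basic_ext R)).

End BasicCategory.

(* Main.v *)
Require Import Defs.
From HB Require Import structures.
From mathcomp Require Import all_boot all_order all_algebra.
From mathcomp Require Import all_classical all_reals all_analysis.
From mathcomp Require Import finmap lra.

(* A locally compact Hausdorff space X is sent to the inclusion of its bounded
   continuous functions C*(X) into its bounded functions B(X), and a continuous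
   map to composition with it.  This contravariant functor is faithful because
   B(Y) contains the indicators of points; it is full because a normal
   homomorphism s : B(Y) -> B(X) preserves the join 1 of these indicators, so
   that over each x some s(1_y) takes the value 1, which forces s(f)(x) = f(y).
   It is essentially surjective because a basic algebra B is the algebra of all
   bounded functions on its isolated maximal l-ideals, which correspond to the
   atoms of B.  The topology of a basic extension A -> B is generated by the
   cozero sets of the elements of A, so A consists of continuous functions; by
   maximality it contains all of them, and if a is a compact element with
   a(x) > 0, then {|a| >= a(x)/2} is a compact neighbourhood of x.
   Identities and inequalities in an arbitrary algebra are checked modulo every
   maximal l-ideal, where the algebra becomes R. *)

Set Implicit Arguments.
Unset Strict Implicit.
Unset Printing Implicit Defensive.

Import Order.TTheory GRing.Theory Num.Theory.
Import numFieldNormedType.Exports.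

Local Open Scope classical_set_scope.
Local Open Scope ring_scope.

(** * Residues modulo maximal l-ideals *)

Section BalHom.
Context {R : realType} {A B : balType R} (f : bal_hom A B).

Lemma bal_homD a b : f (a + b) = f a + f b.
Proof. by case: (bal_homP f) => fl _ _ _; rewrite -[a]scale1r fl !scale1r. Qed.

Lemma bal_hom0 : f 0 = 0.
Proof. by rewrite -[LHS](addrK (f 0)) -bal_homD addr0 subrr. Qed.

Lemma bal_homZ r a : f (r *: a) = r *: f a.
Proof.
by case: (bal_homP f) => fl _ _ _; rewrite -[r *: a]addr0 fl bal_hom0 addr0.
Qed.

Lemma bal_homN a : f (- a) = - f a.
Proof. by rewrite -scaleN1r bal_homZ scaleN1r. Qed.

Lemma bal_homB a b : f (a - b) = f a - f b.
Proof. by rewrite bal_homD bal_homN. Qed.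

Lemma bal_hom1 : f 1 = 1.
Proof. by case: (bal_homP f) => _ []. Qed.

Lemma bal_homM a b : f (a * b) = f a * f b.
Proof. by case: (bal_homP f) => _ []. Qed.

Lemma bal_hom_meet a b : f (Order.meet a b) = Order.meet (f a) (f b).
Proof. by case: (bal_homP f). Qed.

Lemma bal_hom_join a b : f (Order.join a b) = Order.join (f a) (f b).
Proof. by case: (bal_homP f). Qed.

Lemma bal_hom_le a b : a <= b -> f a <= f b.
Proof. by rewrite !leEmeet -bal_hom_meet => /eqP ->. Qed.

Lemma bal_hom_inj_le : injective f -> forall a b, (f a <= f b) = (a <= b).
Proof.
move=> fI a b; apply/idP/idP; last exact: bal_hom_le.
by rewrite leEmeet -bal_hom_meet => /eqP /fI; rewrite leEmeet => ->.
Qed.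

End BalHom.

Section Residue.
Context {R : realType} {A : balType R} (M : max_space A).
Implicit Types (a b : A) (r s : R).

Local Notation one := (1 : A).

Let Mm := max_idealP M.
Let Mi : l_ideal M. Proof. by case: Mm. Qed.

(** This is the quotient map of [A] by [M], with quotient [R]; by [residue_uniq] the choice of
    witness does not matter. *)
Definition residue a : R := projT1 (cid (max_residue Mm a)).

Lemma residueP a : max_ideal M (a - residue a *: one).
Proof. exact: (projT2 (cid (max_residue Mm a))). Qed.

Lemma max_ideal0 : max_ideal M 0. Proof. by case: Mi. Qed.

Lemma max_idealD a b : max_ideal M a -> max_ideal M b -> max_ideal M (a + b).
Proof. by case: Mi => _ + _ _; apply. Qed.

Lemma max_idealZ r a : max_ideal M a -> max_ideal M (r *: a).
Proof. exact: l_idealZ. Qed.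

Lemma max_idealB a b : max_ideal M a -> max_ideal M b -> max_ideal M (a - b).
Proof. by move=> Ma Mb; rewrite -scaleN1r; exact/max_idealD/max_idealZ. Qed.

(** Two candidates differ by a scalar lying in [M], and a nonzero scalar in [M] would put 1 into
    [M]. *)
Lemma residue_uniq a r : max_ideal M (a - r *: one) -> residue a = r.
Proof.
move=> Mar; have := max_idealB Mar (residueP a).
rewrite opprB addrC addrA subrK -scalerBl => Mrr; apply/eqP.
rewrite -subr_eq0; apply/negPn/negP => d0.
apply: (max_notin1 Mm).
by have := max_idealZ (residue a - r)^-1 Mrr; rewrite scalerA mulVf // scale1r.
Qed.

Lemma residue_eq0 a : residue a = 0 <-> max_ideal M a.
Proof.
split=> [r0|Ma]; first by have := residueP a; rewrite r0 scale0r subr0.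
by apply: residue_uniq; rewrite scale0r subr0.
Qed.

Lemma residueD a b : residue (a + b) = residue a + residue b.
Proof.
apply: residue_uniq; rewrite scalerDl opprD addrACA.
by apply: max_idealD; exact: residueP.
Qed.

Lemma residueZ r a : residue (r *: a) = r * residue a.
Proof.
by apply: residue_uniq; rewrite -scalerA -scalerBr; exact/max_idealZ/residueP.
Qed.

Lemma residueN a : residue (- a) = - residue a.
Proof. by rewrite -scaleN1r residueZ mulN1r. Qed.

Lemma residueB a b : residue (a - b) = residue a - residue b.
Proof. by rewrite residueD residueN. Qed.

Lemma residue0 : residue 0 = 0.
Proof. exact/residue_eq0/max_ideal0. Qed.

Lemma residue1 : residue 1 = 1.
Proof. by apply: residue_uniq; rewrite scale1r subrr; exact: max_ideal0. Qed.

Lemma residueM a b : residue (a * b) = residue a * residue b.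
Proof.
apply: residue_uniq.
have -> : a * b - (residue a * residue b) *: one =
    (a - residue a *: one) * b + residue a *: (b - residue b *: one).
  by rewrite mulrBl -l_scalerAl mul1r scalerBr scalerA addrA subrK.
apply: max_idealD; last exact/max_idealZ/residueP.
by case: Mi => _ _ /(_ b _ (residueP a))[].
Qed.

(** A negative residue would place the positive scalar [- residue a] below [a - residue a], an
    element of [M]. *)
Lemma residue_ge0 a : 0 <= a -> 0 <= residue a.
Proof.
move=> a0; rewrite leNgt; apply/negP => r0.
apply: (@max_notin_scale1 _ _ _ Mm (- residue a) _ _ _ (residueP a)).
  by rewrite oppr_gt0.
by rewrite -scaleNr -{1}[- residue a *: _]add0r; exact: l_leD2r.
Qed.

Lemma residue_le a b : a <= b -> residue a <= residue b.
Proof.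
by rewrite -l_subr_ge0 => /residue_ge0; rewrite residueB subr_ge0.
Qed.

(** The positive and negative parts of [a] are disjoint and [M] is prime, so one of them has residue
    0; the other then carries the residue of [a] up to sign. *)
Lemma residue_pos a : residue (Order.join a 0) = Num.max (residue a) 0.
Proof.
have aE : residue a = residue (Order.join a 0) - residue (Order.join (- a) 0).
  rewrite -residueB; congr residue.
  have <- : Order.join (- a) 0 + a = Order.join a 0.
    by rewrite l_joinD addNr add0r joinC.
  by rewrite addrAC subrr add0r.
have p0 : 0 <= residue (Order.join a 0) by exact/residue_ge0/leUr.
have n0 : 0 <= residue (Order.join (- a) 0) by exact/residue_ge0/leUr.
have : max_ideal M (Order.meet (Order.join a 0) (Order.join (- a) 0)).
  by rewrite l_meet_pos_neg; exact: max_ideal0.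
case/(max_prime Mm (leUr _ _) (leUr _ _)) => /residue_eq0 z.
  by rewrite aE z sub0r max_r // oppr_le0.
by rewrite aE z subr0 max_l.
Qed.

Lemma residue_join a b :
  residue (Order.join a b) = Num.max (residue a) (residue b).
Proof.
have -> : Order.join a b = Order.join (a - b) 0 + b.
  by rewrite l_joinD subrK add0r.
by rewrite residueD residue_pos residueB addr_maxl subrK add0r.
Qed.

Lemma residue_meet a b :
  residue (Order.meet a b) = Num.min (residue a) (residue b).
Proof.
rewrite -[Order.meet a b]opprK l_oppI residueN residue_join !residueN.
by rewrite oppr_max !opprK.
Qed.

Lemma residue_labs a : residue (labs a) = `|residue a|.
Proof. by rewrite /labs residue_join residueN maxrN. Qed.

End Residue.

Definition residueE := (@residueD, @residueN, @residueZ, @residue0, @residue1,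
  @residueM, @residue_join, @residue_meet, @residue_labs).

(** * Separation of elements by maximal l-ideals *)

Section Yosida.
Context {R : realType} {A : balType R}.
Implicit Types (a b c : A) (I J : set A).

Lemma max_ideal_exists I : l_ideal I -> ~ I 1 ->
  exists M : max_space A, I `<=` M.
Proof.
move=> Ii I1; have [I0 _ _ _] := Ii.
pose P := [set J | J = set0 \/ [/\ l_ideal J, ~ J 1 & I `<=` J]].
have [F FP Ft|M [PM Mmax]] := @Zorn_bigcup _ P.
  have [allE|] := pselect (forall J, F J -> J = set0).
    left; apply/seteqP; split=> // a [J FJ]; rewrite (allE _ FJ) //.
  move=> /existsNP[J /not_implyP[FJ JN0]]; right.
  have ideal K a : F K -> K a -> [/\ l_ideal K, ~ K 1 & I `<=` K].
    by move=> FK Ka; case: (FP _ FK) => [K0|//]; rewrite K0 in Ka.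
  have [//|[[J0 _ _ _] _ IJ]] := FP _ FJ.
  split; first split.
  - by exists J.
  - move=> a b [K FK Ka] [L FL Lb].
    have [[_ KD _ _] _ _] := ideal _ _ FK Ka.
    have [[_ LD _ _] _ _] := ideal _ _ FL Lb.
    have [KL|LK] := Ft _ _ FK FL.
      by exists L => //; apply: LD => //; exact: KL.
    by exists K => //; apply: KD => //; exact: LK.
  - move=> c a [K FK Ka]; have [[_ _ KM _] _ _] := ideal _ _ FK Ka.
    by have [? ?] := KM c a Ka; split; exists K.
  - move=> a b ab [K FK Kb]; have [[_ _ _ Ks] _ _] := ideal _ _ FK Kb.
    by exists K => //; exact: Ks ab Kb.
  - by move=> [K FK K1]; have [_ /(_ K1)] := ideal _ _ FK K1.
  - by move=> a /IJ Ja; exists J.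
have [M0|[Mi M1 IM]] := PM.
  exfalso; apply: (Mmax I); last by right; split.
  by rewrite M0; split=> // /(_ _ I0).
have Mm : maximal_l_ideal M.
  split=> [//|MT|J Ji MJ]; first by apply: M1; rewrite MT.
  have [->|/eqP JM] := eqVneq J M; [by left|right].
  have [J1|J1] := pselect (J 1); first exact: (l_ideal1 Ji).
  exfalso; apply: (Mmax J); last by right; split=> //; exact: subset_trans MJ.
  by split=> // JM'; apply: JM; apply/seteqP.
by exists (MaxSpace Mm).
Qed.

Lemma l_ideal_set0 : l_ideal [set (0 : A)].
Proof.
split=> //= [a b -> ->|c a ->|a b + b0].
- by rewrite addr0.
- by rewrite mulr0 mul0r.
rewrite b0 (@l_abs_id _ 0) // l_abs_le => /andP[a0 Na0]; apply/le_anti.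
by rewrite a0 -l_leN oppr0.
Qed.

(* A witness is any maximal ideal containing [(1 - n a)^+] for an [n] such that
   [n a] is not below [1]. *)
Lemma residue_neq0 a : 0 <= a -> a <> 0 ->
  exists M : max_space A, residue M a <> 0.
Proof.
move=> a0 aN0.
have [n xN0] : exists n, Order.join (a *+ n - 1) 0 <> 0.
  apply: contrapT => /forallNP all0; apply: aN0; apply/le_anti.
  rewrite a0 andbT; apply: (@bal_archimedean _ A _ 1) => n.
  have /contrapT x0 := all0 n.
  have : a *+ n - 1 <= 0 by rewrite -[leRHS]x0 leUl.
  by move=> /(l_leD2r 1); rewrite subrK add0r.
set x := Order.join _ _ in xN0.
pose y := Order.join (- (a *+ n - 1)) 0.
have x0 : 0 <= x by exact: leUr.
have y0 : 0 <= y by exact: leUr.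
have xy : Order.meet x y = 0 by exact: l_meet_pos_neg.
have Ii := l_ideal_adjoinP y l_ideal_set0.
have [|M IM] := max_ideal_exists Ii.
  move=> [_ [r [-> r0]]]; rewrite add0r !l_abs_id ?bal_ge01 // => ry.
  apply: xN0; apply/le_anti; rewrite x0 andbT.
  have [k k0 xk] := bal_le_scale1 x.
  have k1 : 0 < k + 1 by rewrite ltr_wpDl.
  have r1 : 0 < r + 1 by rewrite ltr_wpDl.
  (* From [1 <= r y] follows [x <= k <= k r y], so [x] lies below [(k + 1) (r + 1) (x /\ y)], which
     is 0. Adding 1 makes both factors positive, as [l_meetZ] requires. *)
  have zr : 0 = (k + 1) *: Order.meet ((r + 1) *: x) ((r + 1) *: y).
    by rewrite -l_meetZ // xy !scaler0.
  rewrite [leRHS]zr l_meetZ // lexI; apply/andP; split.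
    rewrite -[leLHS]scale1r scalerA; apply: l_ler_wpZ => //.
    by rewrite mulrDl mulrDr !mul1r mulr1; nra.
  apply: le_trans xk _; apply: le_trans (l_ler_wpZ2 k0 ry) _.
  by rewrite !scalerA; apply: l_ler_wpZ => //; nra.
have My : max_ideal M y.
  by apply: IM; exists 0, 1; split=> //; rewrite scale1r add0r.
exists M => /residue_eq0 Ma.
apply: (@max_notin_scale1 _ _ _ (max_idealP M) 1 (a *+ n + y)).
- by [].
- rewrite scale1r addrC -[leLHS](subrK (a *+ n)); apply: l_leD2r.
  by rewrite -opprB leUl.
- by apply: max_idealD => //; rewrite -scaler_nat; exact: max_idealZ.
Qed.

(** If all residues of [(a - b)^+] vanish, it is 0 by [residue_neq0]. Inequalities in [A] thus
    become inequalities between reals. *)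
Lemma residue_leP a b :
  a <= b <-> forall M : max_space A, residue M a <= residue M b.
Proof.
split=> [ab M|ab]; first exact: residue_le.
suff p0 : Order.join (a - b) 0 = 0.
  by rewrite -l_subr_ge0 -l_leN oppr0 opprB -[leRHS]p0 leUl.
apply: contrapT => /(residue_neq0 (leUr _ _))[M]; apply.
by rewrite !residueE max_r // subr_le0.
Qed.

Lemma residue_inj a b :
  (forall M : max_space A, residue M a = residue M b) -> a = b.
Proof.
by move=> ab; apply/le_anti/andP; split; apply/residue_leP => M; rewrite ab.
Qed.

End Yosida.

(** * Algebras of bounded functions *)

(** One interface for the bounded functions, the bounded continuous functions and the kernel pairs
    below; negation and minimum are derived from multiplication by -1 and maximum. *)
Record fun_subalg (R : realType) (T : Type) := FunSubalg {
  fsa :> set (T -> R);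
  fsa_cst : forall r, fsa (cst r);
  fsa_add : forall f g, fsa f -> fsa g -> fsa (fun x => f x + g x);
  fsa_mul : forall f g, fsa f -> fsa g -> fsa (fun x => f x * g x);
  fsa_max : forall f g, fsa f -> fsa g -> fsa (fun x => Num.max (f x) (g x));
  fsa_bounded : forall f, fsa f -> exists k, forall x, `|f x| <= k
}.

Record falg (R : realType) (T : Type) (P : fun_subalg R T) := FAlg {
  falg_fun :> T -> R;
  falgP : fsa P falg_fun
}.

Section FunctionAlgebra.
Context {R : realType} {T : Type} (P : fun_subalg R T).
Implicit Types (f g h : falg P) (r : R).

Lemma falg_eq f g : f =1 g -> f = g.
Proof.
case: f g => [f fP] [g gP] /= /funext fg.
by subst g; congr FAlg; exact: Prop_irrelevance.
Qed.

Lemma fsa_opp (u : T -> R) : fsa P u -> fsa P (fun x => - u x).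
Proof.
move=> uP; have -> : (fun x => - u x) = fun x => cst (-1) x * u x.
  by apply/funext => x; rewrite mulN1r.
exact/fsa_mul/uP/fsa_cst.
Qed.

Lemma fsa_min (u v : T -> R) :
  fsa P u -> fsa P v -> fsa P (fun x => Num.min (u x) (v x)).
Proof.
move=> uP vP; have -> : (fun x => Num.min (u x) (v x)) =
    fun x => - Num.max (- u x) (- v x).
  by apply/funext => x; rewrite oppr_max !opprK.
by apply/fsa_opp/fsa_max; exact: fsa_opp.
Qed.

Definition fcst r := FAlg (fsa_cst P r).
Definition fadd f g := FAlg (fsa_add (falgP f) (falgP g)).
Definition fopp f := FAlg (fsa_opp (falgP f)).
Definition fmul f g := FAlg (fsa_mul (falgP f) (falgP g)).
Definition fmax f g := FAlg (fsa_max (falgP f) (falgP g)).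
Definition fmin f g := FAlg (fsa_min (falgP f) (falgP g)).
Definition fscale r f := fmul (fcst r) f.
Definition fle f g := `[< forall x, f x <= g x >].

HB.instance Definition _ := gen_eqMixin (falg P).
HB.instance Definition _ := gen_choiceMixin (falg P).

Lemma faddA : associative fadd.
Proof. by move=> f g h; apply: falg_eq => x /=; rewrite addrA. Qed.
Lemma faddC : commutative fadd.
Proof. by move=> f g; apply: falg_eq => x /=; rewrite addrC. Qed.
Lemma fadd0 : left_id (fcst 0) fadd.
Proof. by move=> f; apply: falg_eq => x /=; rewrite add0r. Qed.
Lemma faddN : left_inverse (fcst 0) fopp fadd.
Proof. by move=> f; apply: falg_eq => x /=; rewrite addNr. Qed.

HB.instance Definition _ :=
  GRing.isZmodule.Build (falg P) faddA faddC fadd0 faddN.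

Lemma fmulA : associative fmul.
Proof. by move=> f g h; apply: falg_eq => x /=; rewrite mulrA. Qed.
Lemma fmul1l : left_id (fcst 1) fmul.
Proof. by move=> f; apply: falg_eq => x /=; rewrite mul1r. Qed.
Lemma fmul1r : right_id (fcst 1) fmul.
Proof. by move=> f; apply: falg_eq => x /=; rewrite mulr1. Qed.
Lemma fmulDl : left_distributive fmul fadd.
Proof. by move=> f g h; apply: falg_eq => x /=; rewrite mulrDl. Qed.
Lemma fmulDr : right_distributive fmul fadd.
Proof. by move=> f g h; apply: falg_eq => x /=; rewrite mulrDr. Qed.

HB.instance Definition _ := GRing.Zmodule_isPzRing.Build (falg P)
  fmulA fmul1l fmul1r fmulDl fmulDr.

Lemma fleP f g : reflect (forall x, f x <= g x) (fle f g).
Proof. exact: asboolP. Qed.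

Lemma flexx : reflexive fle.
Proof. by move=> f; apply/fleP. Qed.
Lemma fle_anti : antisymmetric fle.
Proof.
move=> f g /andP[/fleP fg /fleP gf]; apply: falg_eq => x.
by apply/le_anti; rewrite fg gf.
Qed.
Lemma fle_trans : transitive fle.
Proof.
by move=> f g h /fleP gf /fleP fh; apply/fleP => x; exact: le_trans (fh x).
Qed.
Lemma flexI f g h : fle f (fmin g h) = fle f g && fle f h.
Proof.
apply/fleP/andP => /= [fgh|[/fleP fg /fleP fh] x].
  by split; apply/fleP => x; have := fgh x; rewrite le_min => /andP[].
by rewrite le_min fg fh.
Qed.
Lemma fleUx f g h : fle (fmax f g) h = fle f h && fle g h.
Proof.
apply/fleP/andP => /= [fgh|[/fleP fg /fleP fh] x].
  by split; apply/fleP => x; have := fgh x; rewrite ge_max => /andP[].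
by rewrite ge_max fg fh.
Qed.
Lemma fleD2r f g h : fle f g -> fle (f + h) (g + h).
Proof. by move=> /fleP fg; apply/fleP => x /=; rewrite lerD2r. Qed.
Lemma fmul_ge0 f g : fle 0 f -> fle 0 g -> fle 0 (f * g).
Proof.
by move=> /fleP f0 /fleP g0; apply/fleP => x; apply: (mulr_ge0 (f0 x) (g0 x)).
Qed.

Definition falg_lring : lring := @LRing (falg P)
  (GRing.PzRing.class (falg P : pzRingType)) fle fmin fmax
  flexx fle_anti fle_trans flexI fleUx fleD2r fmul_ge0.

Lemma fscaleA r s f : fscale r (fscale s f) = fscale (r * s) f.
Proof. by apply: falg_eq => x /=; rewrite mulrA. Qed.
Lemma fscale1 : left_id 1 fscale.
Proof. by move=> f; apply: falg_eq => x /=; rewrite mul1r. Qed.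
Lemma fscaleDr : right_distributive fscale fadd.
Proof. by move=> r f g; apply: falg_eq => x /=; rewrite mulrDr. Qed.
Lemma fscaleDl f : {morph (fun r : R => fscale r f) : r s / r + s >-> fadd r s}.
Proof. by move=> r s; apply: falg_eq => x /=; rewrite mulrDl. Qed.
Lemma fscaleAl r f g : fscale r (f * g) = fscale r f * g.
Proof. by apply: falg_eq => x /=; rewrite mulrA. Qed.
Lemma fscaleAr r f g : fscale r (f * g) = f * fscale r g.
Proof. by apply: falg_eq => x /=; rewrite mulrCA. Qed.
Lemma fscale_ge0 r f : 0 <= r -> fle 0 f -> fle 0 (fscale r f).
Proof. by move=> r0 /fleP f0; apply/fleP => x; apply: (mulr_ge0 r0 (f0 x)). Qed.

Definition falg_lalgebra : lalgebra R := @LAlgebra R falg_lring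
  fscale fscaleA fscale1 fscaleDr fscaleDl fscaleAl fscaleAr fscale_ge0.

Lemma falg_bounded (f : falg_lalgebra) : exists n : nat, f <= n%:R.
Proof.
have [k kf] := fsa_bounded (falgP (f : falg P)).
have [n kn] : exists n : nat, k <= n%:R.
  exists (Num.truncn `|k|).+1.
  by apply: le_trans (ler_norm k) _; apply/ltW/truncnS_gt.
exists n; apply/fleP => x.
have -> : (n%:R : falg_lalgebra) = fcst n%:R.
  elim: {kn}n => [|n IHn]; first exact: falg_eq.
  by rewrite -natr1 IHn; apply: falg_eq => y /=; rewrite -natr1.
by apply: le_trans (ler_norm _) _; exact: le_trans (kf x) kn.
Qed.

Lemma falg_archimedean (f g : falg_lalgebra) :
  (forall n : nat, f *+ n <= g) -> f <= 0.
Proof.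
move=> fg; apply/fleP => x; rewrite leNgt; apply/negP => fx0.
have fn (n : nat) : (f *+ n : falg P) x = (f : falg P) x *+ n.
  elim: n => [//|n IHn]; rewrite mulrS [RHS]mulrS -IHn; reflexivity.
set n := (Num.truncn `|(g : falg P) x / (f : falg P) x|).+1.
have /fleP/(_ x) := fg n; rewrite fn -mulr_natr leNgt => /negP; apply.
rewrite -ltr_pdivrMl // mulrC.
exact: le_lt_trans (ler_norm _) (truncnS_gt _).
Qed.

Definition falg_bal : balType R := Bal falg_bounded falg_archimedean.

End FunctionAlgebra.

(** * Isolated maximal l-ideals and atoms *)

Lemma max_space_eq (R : realType) (A : balType R) (M N : max_space A) :
  max_ideal M = max_ideal N -> M = N.
Proof.
case: M N => [M Mm] [N Nm] /= MN; subst N.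
by congr MaxSpace; exact: Prop_irrelevance.
Qed.

Lemma max_space_sub_eq (R : realType) (A : balType R) (M N : max_space A) :
  max_ideal M `<=` max_ideal N -> M = N.
Proof.
move=> MN; apply: max_space_eq.
have [_ _ Mmax] := max_idealP M; have [Ni NT _] := max_idealP N.
by case: (Mmax _ Ni MN) => // NE; case: NT.
Qed.

Ltac case_minmax := repeat match goal with
  | |- context [Order.min ?x ?y] => case: (leP x y) => ?
  | |- context [Order.max ?x ?y] => case: (leP x y) => ?
  end.

Section Isolated.
Context {R : realType} {A : balType R}.
Implicit Types (a b e : A) (M N : max_space A).

(** The complement is the hull of the l-ideal of all elements vanishing wherever [b] does. *)
Lemma open_residue_neq0 b : open [set M : max_space A | residue M b <> 0].
Proof.
exists [set a | forall M : max_space A, residue M b = 0 -> residue M a = 0].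
  split=> /= [M _|a c a0 c0 M b0|c a a0|a c ac c0 M b0].
  - exact: residue0.
  - by rewrite residueD a0 // c0 // addr0.
  - by split=> M b0; rewrite residueM a0 // ?mulr0 ?mul0r.
  - apply/normr0_eq0/le_anti; rewrite normr_ge0 andbT.
    by rewrite -residue_labs (le_trans (residue_le M ac)) // residue_labs c0 //
      normr0.
apply/seteqP; split=> M /=.
  by move=> /contrapT b0 a a0; exact/residue_eq0/a0.
by move=> bM; apply; apply/residue_eq0/bM.
Qed.

(** If [{M}] is the complement of the hull of [I], any [b] in [I] outside [M] lies in every other
    maximal l-ideal. *)
Lemma isolated_maxP M : isolated [set: max_space A] M <->
  exists b, forall N, residue N b <> 0 <-> N = M.
Proof.
split=> [[_ [V]]|[b bM]].
  rewrite nbhsE setIT => -[U [Uo UM] UV] VM.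
  have UE N : U N <-> N = M by split=> [/UV|->//]; rewrite VM.
  case: Uo => I Ii UC.
  have : ~ (I `<=` max_ideal M).
    by move=> IM; have : (~` U) M by rewrite UC.
  move=> /existsNP[b /not_implyP[Ib Mb]]; exists b => N.
  split=> [Nb|->]; last by move=> /residue_eq0.
  apply/UE; apply: contrapT => NU; apply: Nb; apply/residue_eq0.
  by have : (~` U) N by []; rewrite UC; exact.
split; first exact/mem_set.
exists [set M] => //; last by rewrite setIT.
apply: open_nbhs_nbhs; split=> //.
rewrite (_ : [set M] = [set N : max_space A | residue N b <> 0]).
  exact: open_residue_neq0 b.
by apply/seteqP; split=> N /= ?; exact/bM.
Qed.

Lemma residue_idem M e :
  idempotent_elt e -> residue M e = 0 \/ residue M e = 1.
Proof.
move=> /(congr1 (residue M)); rewrite residueM => ee.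
have /eqP : residue M e * (residue M e - 1) = 0.
  by rewrite mulrBr mulr1 ee subrr.
by rewrite mulf_eq0 subr_eq0 => /orP[]/eqP; [left|right].
Qed.

Lemma idem_residue e : (forall M, residue M e = 0 \/ residue M e = 1) ->
  idempotent_elt e.
Proof.
move=> e01; apply: residue_inj => M; rewrite residueM.
by case: (e01 M) => ->; rewrite ?mulr0 ?mulr1.
Qed.

Lemma idem_ge0 e : idempotent_elt e -> 0 <= e.
Proof.
move=> ee; apply/residue_leP => M; rewrite residue0.
by case: (residue_idem M ee) => ->.
Qed.

End Isolated.

(** * Atoms and isolated points of a basic algebra *)

Section Basic.
Context {R : realType} {B : balType R}.
Implicit Types (a b c e s t u : B) (M N : max_space B).

(* [u] is the supremum of the elements [n b /\ 1]; it is idempotent because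
   [2 u /\ 1 <= u]. *)
Lemma carrier_idempotent b : dedekind_complete B -> 0 <= b ->
  exists u, [/\ idempotent_elt u, Order.meet b 1 <= u &
    forall c, 0 <= c -> Order.meet b c = 0 -> Order.meet u c = 0].
Proof.
move=> Bdc b0; pose S := [set Order.meet (n%:R *: b) 1 | n in [set: nat]].
have Sub1 : ubound S 1 by move=> _ [n _ <-]; exact: leIr.
have [||u [Su uS]] := Bdc S.
- by exists (Order.meet (0%:R *: b) 1); exists 0%N.
- by exists 1.
have uM n M : Num.min (n%:R * residue M b) 1 <= residue M u.
  have <- : residue M (Order.meet (n%:R *: b) 1) =
      Num.min (n%:R * residue M b) 1.
    by rewrite !residueE.
  apply: residue_le.
  by apply: Su; exists n.
have bM M : 0 <= residue M b by exact: residue_ge0.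
have u0 M : 0 <= residue M u by have := uM 0%N M; rewrite mul0r min_l.
have u1 M : residue M u <= 1 by rewrite -(residue1 M); exact/residue_le/uS.
have sup_le t : (forall n M,
    Num.min (n%:R * residue M b) 1 <= residue M t) -> u <= t.
  move=> St; apply: uS => _ [n _ <-]; apply/residue_leP => M.
  by rewrite !residueE.
exists u; split.
- apply: idem_residue => M.
  (* With [v] the residue of [u], this reads [v <= (v + (2 v - 1)^+) / 2], which leaves only 0 and
     1. It holds by comparing the members [n] and [2 n] of the family: where [n b <= 1/2],
     [2 n b <= v], and elsewhere [1 <= v]. *)
  have : u <= 2^-1 *: (u + Order.join (2 *: u - 1) 0).
    apply: sup_le => n {}M; rewrite !residueE.
    have := uM n M; have := uM (n + n)%N M; have := u0 M; rewrite natrD mulrDl.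
    by move: (n%:R * _) => x; case_minmax; lra.
  move=> /(residue_le M); rewrite !residueE.
  by have := u0 M; have := u1 M; case_minmax; [left|right]; lra.
- by apply: Su; exists 1%N => //; rewrite scale1r.
- move=> c c0 bc; apply: residue_inj => M; apply/le_anti.
  (* The right side still bounds the family: where [b] vanishes the family is 0, and where [c]
     vanishes nothing is subtracted. *)
  have : u <= u - Order.meet u c.
    apply: sup_le => n {}M; rewrite !residueE.
    have := congr1 (residue M) bc; have := uM n M; have := u0 M.
    have := bM M; have := residue_ge0 M c0; rewrite !residueE.
    move: (residue M b) (residue M c) (residue M u) => x y z.
    case: (leP x y) => _ y0 x0 z0; last first.
      by move=> + y00; rewrite y00; case_minmax; lra.
    by move=> + x00; rewrite x00 mulr0 (min_l ler01); case_minmax; lra.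
  move=> /(residue_le M); rewrite !residueE le_min u0 residue_ge0 // andbT.
  by lra.
Qed.

(** Take an atom [e] below the carrier [u] of [b]: if [b] and [e] were disjoint, so would be [u] and
    [e]. *)
Lemma basic_atom b : basic_algebra B -> 0 <= b -> b <> 0 ->
  exists2 e, idempotent_atom e & Order.meet b e <> 0.
Proof.
move=> [Bdc Bat] b0 bN0.
have [u [uu bu udisj]] := carrier_idempotent Bdc b0.
have uN0 : u <> 0.
  move=> u0; apply: bN0; apply: residue_inj => M.
  have := residue_le M bu; rewrite u0 !residueE.
  by have := residue_ge0 M b0; case_minmax; lra.
have [e eat eu] := Bat u uu uN0; exists e => // be.
have [ee eN0 _] := eat; apply: eN0; apply: residue_inj => M; rewrite residue0.
have := congr1 (residue M) eu.
have := congr1 (residue M) (udisj e (idem_ge0 ee) be); rewrite !residueE.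
by case: (residue_idem M ee) => -> //; rewrite mul1r => /[swap] ->;
  rewrite minxx.
Qed.

(** If [e] were 1 at two points [M] and [N], an idempotent [u] with residue 0 at [M] and 1 at [N]
    would make [u e] an idempotent strictly between 0 and [e]. Such a [u] is the carrier of
    [(|c| - d)^+], where [c] vanishes at [M] but not at [N] and [d] is half of [|c|] at [N]. *)
Lemma atom_residue e : basic_algebra B -> idempotent_atom e ->
  exists M, forall N, residue N e = (N == M)%:R.
Proof.
move=> [Bdc Bat] [ee eN0 emin].
have [M eM] := residue_neq0 (idem_ge0 ee) eN0; exists M => N.
have eM1 : residue M e = 1 by case: (residue_idem M ee).
have [->|NM] := eqVneq N M; first by [].
case: (residue_idem N ee) => // eN1; exfalso.
have [c Mc Nc] : exists2 c, max_ideal M c & ~ max_ideal N c.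
  apply: contrapT => H; case/eqP: NM; apply/esym/max_space_sub_eq => c Mc.
  by apply: contrapT => Nc; apply: H; exists c.
have {}Nc : 0 < `|residue N c|.
  by rewrite normr_gt0; apply/eqP => /residue_eq0.
move/residue_eq0: Mc => Mc; pose d := `|residue N c| / 2.
have d0 : 0 < d by rewrite divr_gt0.
pose p : B := labs c - d *: (1 : B).
have p0 : (0 : B) <= Order.join p 0 by exact: leUr.
have [u [uu bu udisj]] := carrier_idempotent Bdc p0.
(* The carrier is disjoint from the negative part of [p], whose residue at [M] is [d > 0]. *)
have uM : residue M u = 0.
  have := congr1 (residue M) (udisj _ (leUr _ _) (l_meet_pos_neg p)).
  rewrite !residueE Mc normr0 sub0r mulr1 opprK max_l ?(ltW d0) //.
  by case: (residue_idem M uu) => -> //; case_minmax; lra.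
have uN : residue N u = 1.
  case: (residue_idem N uu) => // uN; have := residue_le N bu.
  rewrite uN !residueE mulr1; move: Nc d0; rewrite /d.
  by case_minmax; lra.
have ueI : idempotent_elt (u * e).
  apply: idem_residue => P; rewrite residueM.
  by case: (residue_idem P uu) => ->; case: (residue_idem P ee) => ->;
    rewrite ?mulr0 ?mul0r ?mulr1; [left|left|left|right].
have ueE : u * e * e = u * e by rewrite -mulrA ee.
case: (emin _ ueI ueE) => [/(congr1 (residue N))|/(congr1 (residue M))].
  by rewrite !residueE uN eN1; lra.
by rewrite !residueE uM eM1; lra.
Qed.

(** Some [b] is nonzero at [M] only. An atom meeting [|b|] is concentrated at a point where [b] is
    nonzero, which is [M]. *)
Lemma isolated_atom M : basic_algebra B -> isolated [set: max_space B] M ->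
  exists e, forall N, residue N e = (N == M)%:R.
Proof.
move=> Bb /isolated_maxP[b bM].
have bN0 : labs b <> 0.
  move=> /(congr1 (residue M)); rewrite !residueE => /eqP.
  by rewrite normr_eq0 => /eqP; exact/bM.
have [e eat be] := basic_atom Bb (l_abs_ge0 b) bN0.
have [M' eM'] := atom_residue Bb eat; exists e => N.
suff <- : M' = M by exact: eM'.
apply: (bM M').1 => b0; apply: be; apply: residue_inj => P.
have [ee _ _] := eat; have e0 := residue_ge0 P (idem_ge0 ee).
rewrite !residueE; rewrite eM'; case: eqP => [->|_].
  by rewrite b0 normr0 min_l.
by rewrite mulr0n min_r.
Qed.

Definition isolated_pt M (iM : isolated [set: max_space B] M) :
    isolated_max B :=
  SigSub (mem_set iM).

Lemma isolated_max_eq (x y : isolated_max B) : set_val x = set_val y -> x = y.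
Proof. exact: val_inj. Qed.

Lemma isolated_maxW (x : isolated_max B) :
  isolated [set: max_space B] (set_val x).
Proof. exact: set_valP. Qed.

Lemma atom_at (x : isolated_max B) : basic_algebra B ->
  exists e, forall y : isolated_max B, residue (set_val y) e = (y == x)%:R.
Proof.
move=> Bb; have [e eP] := isolated_atom Bb (isolated_maxW x).
by exists e => y; rewrite eP.
Qed.

(** A nonzero [(a - b)^+] would meet an atom, and the point carrying that atom is isolated, where
    [a <= b] is assumed. *)
Lemma basic_leP a b : basic_algebra B ->
  (forall x : isolated_max B, residue (set_val x) a <= residue (set_val x) b) ->
  a <= b.
Proof.
move=> Bb ab; suff p0 : Order.join (a - b) 0 = 0.
  by rewrite -l_subr_ge0 -l_leN oppr0 opprB -[leRHS]p0 leUl.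
apply: contrapT => /(basic_atom Bb (leUr _ _))[e eat]; apply.
have [M eM] := atom_residue Bb eat.
have iM : isolated [set: max_space B] M.
  apply/isolated_maxP; exists e => N; rewrite eM.
  by case: eqP; split=> //; rewrite ?oner_eq0 // => _; apply/eqP/oner_neq0.
apply: residue_inj => N; rewrite !residueE eM; case: eqP => [->|_].
  have := ab (isolated_pt iM); rewrite /= -subr_le0 => /max_r ->.
  by rewrite min_l.
by rewrite mulr0n min_r // le_max lexx orbT.
Qed.

Lemma basic_inj a b : basic_algebra B ->
  (forall x : isolated_max B, residue (set_val x) a = residue (set_val x) b) ->
  a = b.
Proof.
move=> Bb ab; apply/le_anti/andP.
by split; apply: basic_leP => // x; rewrite ab.
Qed.

(** Suprema are computed pointwise on isolated points: if [s] exceeded [m] at [x], lowering it to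
    [m] there, by a multiple of the atom at [x], would give a smaller upper bound. *)
Lemma residue_sup_le (x : isolated_max B) (S : set B) s (m : R) :
  basic_algebra B -> supremums S s ->
  (forall t, S t -> residue (set_val x) t <= m) -> residue (set_val x) s <= m.
Proof.
move=> Bb [Ss sS] Sm; rewrite leNgt; apply/negP => ms.
have [e eP] := atom_at x Bb.
have /(residue_le (set_val x)) : s <= s - (residue (set_val x) s - m) *: e.
  apply: sS => t St; apply: basic_leP => // y; rewrite !residueE eP.
  have [->|_] := eqVneq y x; first by rewrite mulr1n; have := Sm _ St; lra.
  by rewrite mulr0n mulr0 subr0; exact/residue_le/Ss.
by rewrite !residueE eP eqxx mulr1n; lra.
Qed.

Lemma residue_inf_ge (x : isolated_max B) (S : set B) s (m : R) :
  basic_algebra B -> infimums S s ->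
  (forall t, S t -> m <= residue (set_val x) t) -> m <= residue (set_val x) s.
Proof.
move=> Bb [Ss sS] Sm; rewrite leNgt; apply/negP => ms.
have [e eP] := atom_at x Bb.
have /(residue_le (set_val x)) : s + (m - residue (set_val x) s) *: e <= s.
  apply: sS => t St; apply: basic_leP => // y; rewrite !residueE eP.
  have [->|_] := eqVneq y x; first by rewrite mulr1n; have := Sm _ St; lra.
  by rewrite mulr0n mulr0 addr0; exact/residue_le/Ss.
by rewrite !residueE eP eqxx mulr1n; lra.
Qed.

Lemma basic_surj (g : isolated_max B -> R) (k : R) : basic_algebra B ->
  (forall x, `|g x| <= k) ->
  exists b, forall x : isolated_max B, residue (set_val x) b = g x.
Proof.
move=> Bb gk; have [Bdc _] := Bb.
have /choice[e eP] x := atom_at x Bb.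
have gk' x : 0 <= g x + k <= k + k by have := gk x; rewrite ler_norml; lra.
(* The shift by [k] makes all values nonnegative, so that the multiples of other atoms, being 0 at
   [x], do not affect the supremum there. The element 0 keeps [S] nonempty if there are no isolated
   points. *)
pose S := [set (g x + k) *: e x | x in [set: isolated_max B]] `|` [set 0].
have [||s sS] := Bdc S.
- by exists 0; right.
- exists ((k + k) *: (1 : B)) => t St; apply: basic_leP => // y.
  rewrite !residueE mulr1; case: St => [[x _ <-]|->].
    rewrite !residueE eP; have := gk' x; have := gk' y.
    by case: eqP => _; rewrite ?mulr1n ?mulr0n; lra.
  by rewrite residue0; have := gk' y; lra.
exists (s - k *: (1 : B)) => x; rewrite !residueE mulr1.
suff -> : residue (set_val x) s = g x + k by rewrite addrK.
apply/le_anti/andP; split.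
  apply: residue_sup_le Bb sS _ => t [[y _ <-]|->]; last first.
    by rewrite residue0; have := gk' x; lra.
  rewrite !residueE eP; have := gk' x.
  by have [->|_] := eqVneq x y; rewrite ?mulr1n ?mulr0n; lra.
have <- : residue (set_val x) ((g x + k) *: e x) = g x + k.
  by rewrite !residueE eP eqxx mulr1n mulr1.
by apply: residue_le; case: sS => + _; apply; left; exists x.
Qed.

End Basic.

(** * Homomorphisms into function algebras; monomorphisms *)

Section FunctionAlgebraTheory.
Context {R : realType}.

Definition fval (T : Type) (P : fun_subalg R T) (f : falg_bal P) : T -> R :=
  falg_fun (f : falg P).

Section Values.
Context {T : Type} {P : fun_subalg R T}.
Implicit Types f g : falg_bal P.

Lemma fvalP f : fsa P (fval f). Proof. exact: falgP. Qed.

Lemma fval_inj f g : fval f =1 fval g -> f = g.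
Proof. exact: falg_eq. Qed.

Lemma fval_leP f g : f <= g <-> forall x, fval f x <= fval g x.
Proof. by split=> [/fleP//|fg]; apply/fleP. Qed.

Lemma fvalD f g x : fval (f + g) x = fval f x + fval g x. Proof. by []. Qed.
Lemma fvalN f x : fval (- f) x = - fval f x. Proof. by []. Qed.
Lemma fvalM f g x : fval (f * g) x = fval f x * fval g x. Proof. by []. Qed.
Lemma fvalZ r f x : fval (r *: f) x = r * fval f x. Proof. by []. Qed.
Lemma fval0 x : fval (0 : falg_bal P) x = 0. Proof. by []. Qed.
Lemma fval1 x : fval (1 : falg_bal P) x = 1. Proof. by []. Qed.
Lemma fval_join f g x :
  fval (Order.join f g) x = Num.max (fval f x) (fval g x).
Proof. by []. Qed.
Lemma fval_meet f g x :
  fval (Order.meet f g) x = Num.min (fval f x) (fval g x).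
Proof. by []. Qed.
Lemma fval_labs f x : fval (labs f) x = `|fval f x|.
Proof. by rewrite /labs fval_join fvalN maxrN. Qed.

End Values.

Definition fvalE := (@fval_labs, @fvalD, @fvalN, @fvalZ, @fval0, @fval1,
  @fvalM, @fval_join, @fval_meet).

Definition fmk (T : Type) (P : fun_subalg R T) (u : T -> R) (uP : fsa P u) :
  falg_bal P := FAlg uP.

End FunctionAlgebraTheory.

Arguments fval : simpl never.

Lemma residue_bounded (R : realType) (A : balType R) (a : A) :
  exists k : R, forall M : max_space A, `|residue M a| <= k.
Proof.
have [k k0 ak] := bal_le_scale1 (labs a); exists k => M.
by have := residue_le M ak; rewrite !residueE mulr1.
Qed.

Section Homs.
Context {R : realType}.

Lemma representation_is_hom (A : balType R) (T : Type) (P : fun_subalg R T)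
    (p : T -> max_space A) (pP : forall a, fsa P (fun x => residue (p x) a)) :
  is_bal_hom (fun a => fmk (pP a) : falg_bal P).
Proof.
split=> [r a b||a b|a b]; last 2 first.
- by apply: fval_inj => x; rewrite fval_meet /fval /= residue_meet.
- by apply: fval_inj => x; rewrite fval_join /fval /= residue_join.
- by apply: fval_inj => x; rewrite fvalD fvalZ /fval /= !residueE.
split; last move=> a b.
  by apply: fval_inj => x; rewrite fval1 /fval /= residue1.
by apply: fval_inj => x; rewrite fvalM /fval /= residueM.
Qed.

Definition representation (A : balType R) (T : Type) (P : fun_subalg R T)
    (p : T -> max_space A) (pP : forall a, fsa P (fun x => residue (p x) a)) :
  bal_hom A (falg_bal P) := BalHom (representation_is_hom pP).

Lemma pullback_is_hom (T U : Type) (P : fun_subalg R U) (Q : fun_subalg R T)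
    (p : T -> U) (pP : forall f, fsa P f -> fsa Q (f \o p)) :
  is_bal_hom (fun f : falg_bal P => fmk (pP _ (fvalP f)) : falg_bal Q).
Proof.
split=> [r a b||a b|a b]; do 1?by apply: fval_inj.
by split=> [|a b]; apply: fval_inj.
Qed.

Definition pullback (T U : Type) (P : fun_subalg R U) (Q : fun_subalg R T)
    (p : T -> U) (pP : forall f, fsa P f -> fsa Q (f \o p)) :
  bal_hom (falg_bal P) (falg_bal Q) := BalHom (pullback_is_hom pP).

Lemma bal_hom_factor (A C D : balType R) (f : bal_hom A C) (g : bal_hom D C) :
  injective f -> range g `<=` range f ->
  exists d : bal_hom D A, bal_comp f d = g.
Proof.
move=> fI gf; have /choice[d dP] x : exists a, f a = g x.
  by have [a _ fa] := gf (g x) (ex_intro2 _ _ x Logic.I erefl); exists a.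
suff dh : is_bal_hom d by exists (BalHom dh); exact: bal_hom_eq.
split=> [r x y||x y|x y]; last 2 first.
- by apply: fI; rewrite bal_hom_meet !dP bal_hom_meet.
- by apply: fI; rewrite bal_hom_join !dP bal_hom_join.
- by apply: fI; rewrite bal_homD bal_homZ !dP bal_homD bal_homZ.
split; last move=> x y; first by apply: fI; rewrite dP !bal_hom1.
by apply: fI; rewrite bal_homM !dP bal_homM.
Qed.

Lemma bal_hom_inverse (A C : balType R) (f : bal_hom A C) :
  injective f -> (forall c, exists a, f a = c) ->
  exists g : bal_hom C A, bal_comp f g = bal_id C /\ bal_comp g f = bal_id A.
Proof.
move=> fI fS; have [|g gP] := @bal_hom_factor _ _ _ _ (bal_id C) fI.
  by move=> c _; have [a <-] := fS c; exists a.
exists g; split=> //; apply: bal_hom_eq => a; apply: fI.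
exact: (congr1 (fun h : bal_hom C C => h (f a)) gP).
Qed.

(** A bijective homomorphism reflects the order, hence is an order isomorphism. *)
Lemma surjective_normal (A C : balType R) (f : bal_hom A C) :
  injective f -> (forall c, exists a, f a = c) -> normal_hom f.
Proof.
move=> fI fS T s [Ts sT]; split=> [_ [t Tt <-]|u uT].
  exact/bal_hom_le/Ts.
have [a aE] := fS u; rewrite -aE bal_hom_inj_le //; apply: sT => t Tt.
by rewrite -(bal_hom_inj_le fI) aE; apply: uT; exists t.
Qed.

Lemma injective_mono (A C : balType R) (f : bal_hom A C) :
  injective f -> @monomorphism (bal R) A C f.
Proof.
move=> fI z g h gh; apply: bal_hom_eq => x; apply: fI.
exact: (congr1 (fun k : bal_hom z C => k x) gh).
Qed.

(** * The kernel pair of a homomorphism *)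

Section KernelPair.
Context {A C : balType R} (f : bal_hom A C).

(** A pair [(a, b)] with equal images is encoded as a function on two disjoint copies of the maximal
    spectrum, so that the kernel pair becomes a function algebra. *)
Definition kernel_pair_set : set (bool * max_space A -> R) :=
  [set h | exists a b, f a = f b /\
    forall c, h c = residue c.2 (if c.1 then a else b)].

Lemma kernel_pair_cst r : kernel_pair_set (cst r).
Proof.
exists (r *: (1 : A)), (r *: (1 : A)); split=> // -[b M].
by rewrite if_same !residueE mulr1.
Qed.

Lemma kernel_pair_add g h : kernel_pair_set g -> kernel_pair_set h ->
  kernel_pair_set (fun x => g x + h x).
Proof.
move=> [a [b [ab gE]]] [a' [b' [ab' hE]]]; exists (a + a'), (b + b').
split=> [|[[] M]]; rewrite ?gE ?hE /= ?residueE //.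
by rewrite !bal_homD ab ab'.
Qed.

Lemma kernel_pair_mul g h : kernel_pair_set g -> kernel_pair_set h ->
  kernel_pair_set (fun x => g x * h x).
Proof.
move=> [a [b [ab gE]]] [a' [b' [ab' hE]]]; exists (a * a'), (b * b').
split=> [|[[] M]]; rewrite ?gE ?hE /= ?residueE //.
by rewrite !bal_homM ab ab'.
Qed.

Lemma kernel_pair_max g h : kernel_pair_set g -> kernel_pair_set h ->
  kernel_pair_set (fun x => Num.max (g x) (h x)).
Proof.
move=> [a [b [ab gE]]] [a' [b' [ab' hE]]].
exists (Order.join a a'), (Order.join b b').
split=> [|[[] M]]; rewrite ?gE ?hE /= ?residueE //.
by rewrite !bal_hom_join ab ab'.
Qed.

Lemma kernel_pair_bounded g : kernel_pair_set g ->
  exists k, forall x, `|g x| <= k.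
Proof.
move=> [a [b [_ gE]]]; have [k ka] := residue_bounded a.
have [l lb] := residue_bounded b; exists (Num.max k l) => -[[] M];
  by rewrite gE le_max ?ka ?lb ?orbT.
Qed.

Definition kernel_pair : fun_subalg R (bool * max_space A) :=
  FunSubalg kernel_pair_cst kernel_pair_add kernel_pair_mul kernel_pair_max
    kernel_pair_bounded.

End KernelPair.

Section BoundedFunctions.
Context {T : Type}.

Definition bdd_fun : set (T -> R) :=
  [set f | exists k, forall x, `|f x| <= k].

Lemma bdd_fun_cst r : bdd_fun (cst r).
Proof. by exists `|r|. Qed.

Lemma bdd_fun_add f g : bdd_fun f -> bdd_fun g ->
  bdd_fun (fun x => f x + g x).
Proof.
move=> [k fk] [l gl]; exists (k + l) => x.
by apply: le_trans (ler_normD _ _) _; exact: lerD.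
Qed.

Lemma bdd_fun_mul f g : bdd_fun f -> bdd_fun g ->
  bdd_fun (fun x => f x * g x).
Proof. by move=> [k fk] [l gl]; exists (k * l) => x; rewrite normrM ler_pM. Qed.

Lemma bdd_fun_max f g : bdd_fun f -> bdd_fun g ->
  bdd_fun (fun x => Num.max (f x) (g x)).
Proof.
move=> [k fk] [l gl]; exists (Num.max k l) => x.
by case: (leP (f x) (g x)) => _; rewrite le_max ?fk ?gl ?orbT.
Qed.

Definition bfun_subalg : fun_subalg R T :=
  FunSubalg bdd_fun_cst bdd_fun_add bdd_fun_mul bdd_fun_max
    (fun f fb => fb).

End BoundedFunctions.

Definition bfun (T : Type) : balType R := falg_bal (@bfun_subalg T).

(** The two projections of the kernel pair become equal after [f]; as [f] is mono they are equal,
    and evaluating them at the pair [(a, a')] gives the claim. *)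
Lemma mono_injective (A C : balType R) (f : bal_hom A C) :
  @monomorphism (bal R) A C f -> injective f.
Proof.
move=> fm a a' faa'.
have hatP (c : A) : fsa bfun_subalg (fun M : max_space A => residue M c).
  exact: residue_bounded.
pose hat := representation hatP.
have hatI : injective hat.
  move=> c d /(congr1 (@fval _ _ _)) cd; apply: residue_inj => M.
  exact: (congr1 (fun u => u M) cd).
have prP (b : bool) (u : bool * max_space A -> R) : fsa (kernel_pair f) u ->
    fsa bfun_subalg (u \o pair b).
  by move=> /fsa_bounded[k uk]; exists k => M; exact: uk.
(* Restriction to one copy of the spectrum has values in the image of [hat], so it lifts to a
   projection into [A]. *)
have prR (b : bool) : range (pullback (prP b)) `<=` range hat.
  move=> _ [u _ <-]; have [c [d [_ uE]]] := fvalP u.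
  exists (if b then c else d) => //; apply: fval_inj => M.
  by rewrite /fval /= uE.
have [g gP] := bal_hom_factor hatI (prR true).
have [h hP] := bal_hom_factor hatI (prR false).
have gE u M : residue M (g u) = fval u (true, M).
  exact: (congr1 (fun k : bal_hom _ (bfun (max_space A)) => fval (k u) M) gP).
have hE u M : residue M (h u) = fval u (false, M).
  exact: (congr1 (fun k : bal_hom _ (bfun (max_space A)) => fval (k u) M) hP).
have gh : g = h.
  apply: (fm (falg_bal (kernel_pair f)) g h); apply: bal_hom_eq => u /=.
  have [c [d [cd uE]]] := fvalP u.
  have -> : g u = c by apply: residue_inj => M; rewrite gE uE.
  by have -> : h u = d by apply: residue_inj => M; rewrite hE uE.
have wP : fsa (kernel_pair f) (fun c => residue c.2 (if c.1 then a else a')).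
  by exists a, a'.
apply: residue_inj => M.
rewrite (_ : residue M a = residue M (g (fmk wP))); last by rewrite gE.
by rewrite gh hE.
Qed.

End Homs.

(** * The topology of an extension and the points of B(X) *)

Section Tau.
Context {R : realType} {A B : balType R} (alpha : bal_hom A B).

Lemma flatE (x : isolated_max B) a :
  max_ideal (flat alpha x) a <-> residue (set_val x) (alpha a) = 0.
Proof. by split=> [?|/residue_eq0//]; apply/residue_eq0. Qed.

(** The cozero sets of the elements of [A] form a base of the topology: an open [V] is cut out by
    the l-ideal of the elements vanishing off [V]. *)
Lemma tauP (V : set (isolated_max B)) : tau alpha V <->
  forall x, V x -> exists a, residue (set_val x) (alpha a) <> 0 /\
    forall y, ~ V y -> residue (set_val y) (alpha a) = 0.
Proof.
split=> [[U [I Ii UI] <-] x Ux|H].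
  have : ~ (I `<=` max_ideal (flat alpha x)).
    by move=> Ix; have : (~` U) (flat alpha x) by rewrite UI.
  move=> /existsNP[a /not_implyP[Ia xa]]; exists a; split.
    by move=> /flatE.
  move=> y Uy; apply/flatE.
  by have : (~` U) (flat alpha y) by []; rewrite UI; exact.
pose I := [set a | forall y, ~ V y -> residue (set_val y) (alpha a) = 0].
exists (~` [set M : max_space A | I `<=` max_ideal M]).
  exists I; last by rewrite setCK.
  split=> /= [y _|a c a0 c0 y Vy|c a a0|a c ac c0 y Vy].
  - by rewrite bal_hom0 residue0.
  - by rewrite bal_homD residueD a0 // c0 // addr0.
  - by split=> y Vy; rewrite bal_homM residueM a0 // ?mulr0 ?mul0r.
  - apply/normr0_eq0/le_anti; rewrite normr_ge0 andbT.
    rewrite -residue_labs -bal_hom_labs.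
    rewrite (le_trans (residue_le _ (bal_hom_le alpha ac))) //.
    by rewrite bal_hom_labs residue_labs c0 // normr0.
apply/seteqP; split=> x /=.
  move=> nI; apply: contrapT => Vx; apply: nI => a aI; apply/flatE; exact: aI.
move=> Vx nI; have [a [a0 aV]] := H x Vx.
by apply: a0; apply/flatE/nI.
Qed.

End Tau.

(** * The basic algebra of all bounded functions on a set *)

Section BoundedFunctionsBasic.
Context {R : realType} {T : Type}.
Local Notation B := (@bfun R T).
Implicit Types (f g : B) (x y : T).

Lemma fpoint_bounded x : fsa (@bfun_subalg R T) (fun y => `[< y = x >]%:R).
Proof. by exists 1 => y; case: asboolP; rewrite ?normr1 ?normr0. Qed.

Definition fpoint x : B := fmk (fpoint_bounded x).

Lemma fpointE x y : fval (fpoint x) y = `[< y = x >]%:R.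
Proof. by []. Qed.

Lemma fpointxx x : fval (fpoint x) x = 1.
Proof. by rewrite fpointE; case: asboolP. Qed.

Lemma fpoint_mul x f : f * fpoint x = fval f x *: fpoint x.
Proof.
apply: fval_inj => y; rewrite fvalM fvalZ fpointE.
by case: asboolP => [->//|_]; rewrite !mulr0.
Qed.

Lemma bfun_dedekind : dedekind_complete B.
Proof.
move=> S [t0 St0] [u uS].
pose s x := sup [set fval t x | t in S].
have sS x : has_sup [set fval t x | t in S].
  split; first by exists (fval t0 x), t0.
  by exists (fval u x) => _ [t St <-]; move/fval_leP: (uS _ St); exact.
have ub t x : S t -> fval t x <= s x.
  by move=> St; apply: (ub_le_sup (sS x).2); exists t.
have lub v x : ubound S v -> s x <= fval v x.
  move=> vS; apply: ge_sup (sS x).1 _ => _ [t St <-].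
  by move/fval_leP: (vS _ St); exact.
(* The pointwise supremum is bounded because it lies between the member [t0] and the bound [u]. *)
have sP : fsa (@bfun_subalg R T) s.
  have [k t0k] := fvalP t0; have [l ul] := fvalP u.
  exists (k + l) => x; have := t0k x; have := ul x.
  have := ub t0 x St0; have := lub u x uS; rewrite !ler_norml.
  by move: (fval t0 x) (fval u x) => a b; lra.
exists (fmk sP); split=> [t St|v vS]; apply/fval_leP => x; first exact: ub.
exact: lub.
Qed.

Lemma bfun_idem f x : idempotent_elt f -> fval f x = 0 \/ fval f x = 1.
Proof.
move=> /(congr1 (fun g : B => fval g x)); rewrite fvalM => ff.
have /eqP : fval f x * (fval f x - 1) = 0 by rewrite mulrBr mulr1 ff subrr.
by rewrite mulf_eq0 subr_eq0 => /orP[]/eqP; [left|right].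
Qed.

Lemma fpoint_atom x : idempotent_atom (fpoint x).
Proof.
split.
- by rewrite /idempotent_elt fpoint_mul fpointxx scale1r.
- move=> /(congr1 (fun g : B => fval g x)); rewrite fpointxx fval0 => /eqP.
  by rewrite oner_eq0.
- move=> f ff; rewrite fpoint_mul => <-.
  by case: (bfun_idem x ff) => ->;
    [left; rewrite scale0r|right; rewrite scale1r].
Qed.

Lemma bfun_basic : basic_algebra B.
Proof.
split=> [|f ff fN0]; first exact: bfun_dedekind.
have [x fx] : exists x, fval f x <> 0.
  apply: contrapT => /forallNP H; apply: fN0; apply: fval_inj => x.
  by apply: contrapT; apply: H.
exists (fpoint x); first exact: fpoint_atom.
apply: fval_inj => y; rewrite fvalM fpointE; case: asboolP => [->|_].
  by case: (bfun_idem x ff) => // ->; rewrite mulr1.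
by rewrite mul0r.
Qed.

Lemma fpoint_ideal_maximal x : maximal_l_ideal [set f : B | fval f x = 0].
Proof.
split.
- split=> [|f g f0 g0|g f f0|f g fg g0] /=.
  + by [].
  + by rewrite fvalD f0 g0 addr0.
  + by rewrite !fvalM f0 mulr0 mul0r.
  + apply/normr0_eq0/le_anti; rewrite normr_ge0 andbT -fval_labs.
    by move/fval_leP: fg => /(_ x); rewrite [X in _ <= X]fval_labs g0 normr0.
- move=> /seteqP[_ /(_ 1 Logic.I)] /=; rewrite fval1 => /eqP.
  by rewrite oner_eq0.
- move=> J Ji MJ; have [|JM] := pselect (J `<=` [set f : B | fval f x = 0]).
    by left; apply/seteqP.
  right; move/existsNP: JM => [f /not_implyP[Jf fx]].
  have [_ JD _ _] := Ji; apply: (l_ideal1 Ji).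
  have -> : 1 = (fval f x)^-1 *: f + (1 - (fval f x)^-1 *: f) :> B.
    by rewrite addrC subrK.
  apply: JD; first exact: l_idealZ.
  by apply: MJ; rewrite /= !fvalE mulVf ?subrr //; exact/eqP.
Qed.

Definition fpoint_ideal x : max_space B := MaxSpace (fpoint_ideal_maximal x).

Lemma residue_fpoint_ideal x f : residue (fpoint_ideal x) f = fval f x.
Proof. by apply: residue_uniq; rewrite /= !fvalE mulr1 subrr. Qed.

(** If the indicator of [x] is nonzero at [N], every [f] vanishing at [x] lies in [N], because its
    product with the indicator is 0. *)
Lemma fpoint_ideal_isolated x :
  isolated [set: max_space B] (fpoint_ideal x).
Proof.
apply/isolated_maxP; exists (fpoint x) => N; split=> [Nx|->]; last first.
  by rewrite residue_fpoint_ideal fpointxx; exact/eqP/oner_neq0.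
apply/esym/max_space_sub_eq => f /= fx; apply/residue_eq0.
have /(congr1 (residue N)) : f * fpoint x = 0 by rewrite fpoint_mul fx scale0r.
by rewrite residueM residue0 => /eqP; rewrite mulf_eq0 => /orP[/eqP//|/eqP].
Qed.

Definition bfun_pt x : isolated_max B := isolated_pt (fpoint_ideal_isolated x).

Lemma residue_bfun_pt x f : residue (set_val (bfun_pt x)) f = fval f x.
Proof. exact: residue_fpoint_ideal. Qed.

Lemma fval_sup_le (S : set B) s x (m : R) : supremums S s ->
  (forall t, S t -> fval t x <= m) -> fval s x <= m.
Proof.
move=> Ss Sm; rewrite -residue_bfun_pt; apply: residue_sup_le bfun_basic Ss _.
by move=> t /Sm; rewrite residue_bfun_pt.
Qed.

End BoundedFunctionsBasic.

(** * Bounded continuous functions *)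

Lemma tau_neq0 (R : realType) (A B : balType R) (alpha : bal_hom A B) a :
  tau alpha [set p | residue (set_val p) (alpha a) <> 0].
Proof.
by apply/tauP => p pa; exists a; split=> // q /contrapT.
Qed.

(** [compact_cover] is stated for pointed spaces, so a nonempty [X] is first given a point; the
    empty space is treated apart. *)
Lemma compact_coverP (X : topologicalType) (K : set X) :
  compact K <-> cover_compact K.
Proof.
have [X0|/set0P[x _]] := eqVneq [set: X] set0; last first.
  pose pX : ptopologicalType :=
    HB.pack (Topological.sort X) (isPointed.Build X x).
  have E : compact K = cover_compact K :=
    congr1 (fun P : set (set X) => P K) (compact_cover pX).
  by rewrite E.
have -> : K = set0 by rewrite -subset0 -X0.
split=> _; last exact: compact0.
by move=> I D f _ _; exists fset0.
Qed.

Section ContinuousFunctions.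
Context {R : realType} {X : topologicalType}.
Implicit Types x y : X.

Lemma continuous_distP (u : X -> R) :
  (forall x (eps : R), 0 < eps -> \forall y \near x, `|u y - u x| < eps) ->
  continuous u.
Proof.
move=> H x; apply/cvgrPdist_lt => eps eps0.
by apply: filterS (H x eps eps0) => y; rewrite distrC.
Qed.

Definition cts_bdd_fun : set (X -> R) :=
  [set f | continuous f /\ bdd_fun f].

Lemma cts_bdd_fun_cst r : cts_bdd_fun (cst r).
Proof. by split; [exact: cst_continuous|exact: bdd_fun_cst]. Qed.

Lemma cts_bdd_fun_add f g : cts_bdd_fun f -> cts_bdd_fun g ->
  cts_bdd_fun (fun x => f x + g x).
Proof.
move=> [fc fb] [gc gb]; split; last exact: bdd_fun_add.
by move=> x; apply: cvgD; [exact: fc|exact: gc].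
Qed.

Lemma cts_bdd_fun_mul f g : cts_bdd_fun f -> cts_bdd_fun g ->
  cts_bdd_fun (fun x => f x * g x).
Proof.
move=> [fc fb] [gc gb]; split; last exact: bdd_fun_mul.
by move=> x; apply: cvgM; [exact: fc|exact: gc].
Qed.

Lemma cts_bdd_fun_max f g : cts_bdd_fun f -> cts_bdd_fun g ->
  cts_bdd_fun (fun x => Num.max (f x) (g x)).
Proof.
move=> [fc fb] [gc gb]; split; last exact: bdd_fun_max.
by move=> x; apply: continuous_max; [exact: fc|exact: gc].
Qed.

Definition cfun_subalg : fun_subalg R X :=
  FunSubalg cts_bdd_fun_cst cts_bdd_fun_add cts_bdd_fun_mul
    cts_bdd_fun_max (fun f fb => fb.2).

Definition cfun : balType R := falg_bal cfun_subalg.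

Implicit Types f g : cfun.

Lemma cfun_continuous f : continuous (fval f). Proof. exact: (fvalP f).1. Qed.

Lemma cfun_open_gt0 f : open [set x | 0 < fval f x].
Proof.
move/continuousP: (@cfun_continuous f) => /(_ [set r | 0 < r]); apply.
exact: open_gt.
Qed.

Lemma cfun_open_neq0 f : open [set x | fval f x <> 0].
Proof.
rewrite (_ : [set x | _] = [set x | 0 < fval (labs f) x]).
  exact: cfun_open_gt0.
by apply/seteqP; split=> x /=; rewrite fval_labs normr_gt0 => /eqP.
Qed.

Lemma cfun_subalg_sub (u : X -> R) : fsa cfun_subalg u -> fsa bfun_subalg u.
Proof. by case. Qed.

Definition cfun_incl : bal_hom cfun (bfun X) :=
  @pullback _ _ _ cfun_subalg bfun_subalg id cfun_subalg_sub.

Lemma cfun_inclE f x : fval (cfun_incl f) x = fval f x. Proof. by []. Qed.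

Lemma cfun_incl_inj : injective cfun_incl.
Proof.
move=> f g fg; apply: fval_inj => x.
by rewrite -cfun_inclE fg.
Qed.

(* At a point [x], the element [(r - |c - u x|)^+] of [C] is nonzero exactly
   where [u = gamma c] is [r]-close to [u x]. *)
Lemma tau_sub_continuous (C : balType R) (gamma : bal_hom C (bfun X)) c :
  tau gamma `<=` tau cfun_incl -> continuous (fval (gamma c)).
Proof.
move=> tau_sub; set u := fval (gamma c).
apply: continuous_distP => x eps eps0.
pose d := Order.join (eps *: (1 : C) - labs (c - u x *: (1 : C))) 0.
have dE y : fval (gamma d) y = Num.max (eps - `|u y - u x|) 0.
  rewrite bal_hom_join bal_homB bal_hom_labs bal_homB !bal_homZ bal_hom1.
  by rewrite bal_hom0 !fvalE !mulr1.
have /tauP/(_ (bfun_pt x)) [|a [ax a0]] := tau_sub _ (tau_neq0 gamma d).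
  rewrite /= residue_bfun_pt dE subrr normr0 subr0 max_l ?(ltW eps0) //.
  exact/eqP/lt0r_neq0.
rewrite residue_bfun_pt cfun_inclE in ax.
have := open_nbhs_nbhs (conj (cfun_open_neq0 a) ax).
apply: filterS => y /= ay; rewrite ltNge; apply/negP => ye.
apply: ay; rewrite -cfun_inclE -residue_bfun_pt; apply: a0 => /=.
by rewrite residue_bfun_pt dE; apply; rewrite max_r // subr_le0.
Qed.

(** Compatibility makes every value of [gamma] continuous, so [gamma] factors through the
    inclusion. *)
Lemma cfun_maximal : maximal_extension cfun_incl.
Proof.
move=> C gamma _ comp; apply: (bal_hom_factor cfun_incl_inj) => _ [c _ <-].
have cP : fsa cfun_subalg (fval (gamma c)).
  split; last exact: (fvalP (gamma c)).
  by apply: tau_sub_continuous; rewrite -comp.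
by exists (fmk cP) => //; exact: fval_inj.
Qed.

(** * Density and local compactness for completely regular spaces *)

Section CompletelyRegular.
Hypotheses (hX : hausdorff_space X) (crX : completely_regular_space X).

Lemma cfun_separation x (U : set X) : open U -> U x ->
  exists f, [/\ fval f x = 1, forall y, 0 <= fval f y <= 1 &
    forall y, ~ U y -> fval f y = 0].
Proof.
move=> Uo Ux.
have := crX (open_closedC Uo) (fun nU => nU Ux).
move=> /(@uniform_separatorP _ R)[f [fc f01 fx fU]].
have fP : fsa cfun_subalg f.
  split=> //; exists 1 => y; have := f01 (f y) (ex_intro2 _ _ y Logic.I erefl).
  by rewrite /= in_itv /= ler_norml; lra.
exists (1 - fmk fP); split=> [|y|y Uy]; rewrite !fvalE.
- by rewrite (_ : fval _ x = 0) ?subr0 //; apply: fx; exists x.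
- have := f01 (f y) (ex_intro2 _ _ y Logic.I erefl).
  by rewrite /= in_itv /= /fval /=; lra.
- by rewrite (_ : fval _ y = 1) ?subrr //; apply: fU; exists y.
Qed.

(** With [k] a bound of [|b|], [b] is the join of the functions [m x] that equal [b] at [x] and [-k]
    elsewhere, and each [m x] is the meet of the continuous functions above it. *)
Lemma cfun_incl_dense : join_meet_dense cfun_incl.
Proof.
move=> b; have [k bk] := fvalP b.
have mP x : fsa (@bfun_subalg R X)
    (fun y => if `[< y = x >] then fval b x else - k).
  exists `|k| => y; have := bk x; case: asboolP => _; last by rewrite normrN.
  by move=> bxk; apply: le_trans bxk (ler_norm k).
pose m x : bfun X := fmk (mP x).
have mxx x : fval (m x) x = fval b x by rewrite /fval /=; case: asboolP.
have mxy x y : y <> x -> fval (m x) y = - k.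
  by move=> yx; rewrite /fval /=; case: asboolP.
have bge x : - k <= fval b x by have := bk x; rewrite ler_norml => /andP[].
exists (range m); last first.
  split=> [_ [x _ <-]|u uS]; apply/fval_leP => y.
    by have [->|/mxy ->] := pselect (y = x); rewrite ?mxx.
  by rewrite -mxx; move/fval_leP: (uS _ (ex_intro2 _ _ y Logic.I erefl)).
move=> _ [x _ <-].
exists [set u | range cfun_incl u /\ m x <= u]; first by move=> u [].
split=> [u []//|l lb]; apply/fval_leP => y.
have [->|yx] := pselect (y = x).
  rewrite mxx; have xP := fsa_cst cfun_subalg (fval b x).
  have /lb/fval_leP/(_ x) // :
    [set u | range cfun_incl u /\ m x <= u] (cfun_incl (fmk xP)).
  split; first by exists (fmk xP).
  apply/fval_leP => z; rewrite cfun_inclE.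
  by have [->|/mxy ->] := pselect (z = x); [rewrite mxx|exact: bge].
have yo : open (~` [set y]).
  by apply: closed_openC; exact/accessible_closed_set1/hausdorff_accessible.
have [f [fx f01 fy]] := cfun_separation yo (fun xy : x = y => yx (esym xy)).
(* This continuous function lies above [m x] and takes the value [-k] at [y]. *)
pose g : cfun := (fval b x + k) *: f - k *: (1 : cfun).
have gE z : fval g z = (fval b x + k) * fval f z - k by rewrite !fvalE mulr1.
have : [set u | range cfun_incl u /\ m x <= u] (cfun_incl g).
  split; first by exists g.
  apply/fval_leP => z; rewrite cfun_inclE gE.
  have [->|/mxy ->] := pselect (z = x); first by rewrite mxx fx mulr1 addrK.
  by rewrite lerBrDr addNr mulr_ge0 // ?(andP (f01 z)).1 // -lerBlDr sub0r.
move=> /lb/fval_leP/(_ y); rewrite cfun_inclE gE mxy // fy ?mulr0 ?sub0r //.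
by move=> /(_ erefl).
Qed.

Lemma cfun_basic_extension : basic_extension cfun_incl.
Proof.
split; [|exact: bfun_basic|exact: cfun_incl_dense].
exact/injective_mono/cfun_incl_inj.
Qed.

(** The join of [T] exceeds [|f|] by [eps], so the open sets where some [t] in [T] exceeds [|f|]
    cover [K]; a finite subcover yields the finite subset. *)
Lemma compact_support_element f (K : set X) :
  compact K -> (forall x, ~ K x -> fval f x = 0) -> compact_element cfun_incl f.
Proof.
move=> Kc f0 eps T s eps0 T0 Ts fs.
have [T00|[t0 Tt0]] : T = set0 \/ T !=set0.
- by have [/eqP|/set0P] := boolP (T == set0); [left|right].
- exists T, s; split=> //; first by rewrite T00; exact: finite_set0.
  apply/fval_leP => x; move/fval_leP: fs => /(_ x).
  by rewrite !fvalE mulr1; move: (fval s x) => sx; lra.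
have Kcov : K `<=` cover T (fun t => [set x | 0 < fval (t - labs f) x]).
  move=> x Kx; apply: contrapT => Kn.
  have : fval s x <= `|fval f x|.
    apply: fval_sup_le Ts _ => _ [t Tt <-]; rewrite leNgt; apply/negP => tx.
    by apply: Kn; exists t => //=; rewrite !fvalE subr_gt0.
  move/fval_leP: fs => /(_ x); rewrite !fvalE mulr1 cfun_inclE.
  by move: (fval s x) => sx; lra.
move/compact_coverP: Kc => Kc.
have [t _|D' D'T KD'] := Kc _ T _ _ Kcov; first exact: cfun_open_gt0.
(* Adding [t0] makes the set nonempty and its join nonnegative off [K]. *)
pose T' := t0 |` [set` D'].
have T'T : T' `<=` T by move=> t [->//|/D'T/set_mem].
have [||s' s'P] := @bfun_dedekind R X (cfun_incl @` T').
- by exists (cfun_incl t0), t0 => //; left.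
- by exists s => _ [t /T'T Tt <-]; apply: Ts.1; exists t.
exists T', s'; split=> //.
  by rewrite finite_setU; split; [exact: finite_set1|exact: finite_fset].
have ts' t x : T' t -> fval t x <= fval s' x.
  move=> T't; rewrite -cfun_inclE; move: x; apply/fval_leP.
  by apply: s'P.1; exists t.
apply/fval_leP => x; rewrite fval_labs cfun_inclE.
have [Kx|/f0 ->] := pselect (K x); last first.
  rewrite normr0; apply: le_trans (ts' t0 x _); last by left.
  by move/fval_leP: (T0 _ Tt0) => /(_ x).
have [t D't /=] := KD' _ Kx; rewrite !fvalE subr_gt0 => ft.
by apply: le_trans (ltW ft) (ts' t x _); right.
Qed.

Hypothesis lX : locally_compact [set: X].

Lemma bump x : exists f (K : set X), [/\ compact K, fval f x = 1,
  forall y, 0 <= fval f y <= 1 & forall y, ~ K y -> fval f y = 0].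
Proof.
have [U] := @lX x Logic.I; rewrite withinET => Ux [Uc _].
have [f [fx f01 fU]] := cfun_separation (open_interior U) (Ux : U° x).
by exists f, U; split=> // y Uy; apply: fU => /interior_subset.
Qed.

(** For a bump function [f] at [x], the product [b f] is a compact element below [b] that agrees
    with [b] at [x]. *)
Lemma cfun_locally_compact : locally_compact_extension cfun_incl.
Proof.
move=> b b0; split=> [_ [a [_ ab] <-]|u uS]; first exact: bal_hom_le.
apply/fval_leP => x; have [f [K [Kc fx f01 fK]]] := bump x.
have b0' y : 0 <= fval b y by move/fval_leP: b0 => /(_ y).
have bfle : b * f <= b.
  apply/fval_leP => y; rewrite fvalM ler_piMr //.
  by case/andP: (f01 y).
have <- : fval (cfun_incl (b * f)) x = fval (cfun_incl b) x.
  by rewrite !cfun_inclE fvalM fx mulr1.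
move: x {fx}; apply/fval_leP; apply: uS; exists (b * f) => //; split=> //.
by apply: compact_support_element Kc _ => y /fK fy; rewrite fvalM fy mulr0.
Qed.

End CompletelyRegular.
End ContinuousFunctions.

Arguments cfun {R} X.

(** * The functor *)

(** The quasi-inverse sends [h] to the unique preimage under [F] of its conjugate by the chosen
    isomorphisms [e]. *)
Lemma fully_faithful_equivalent (C D : category) (F : cfunctor C D) :
  (forall (x y : C) (f g : chom x y), fhom F f = fhom F g -> f = g) ->
  (forall (x y : C) (h : chom (F x) (F y)), exists f, fhom F f = h) ->
  (forall y : D, exists (x : C) (e : chom y (F x)), isomorphism e) ->
  equivalent C D.
Proof.
move=> faith full esurj.
pose o y := projT1 (cid (esurj y)).
pose e y : chom y (F (o y)) := projT1 (cid (projT2 (cid (esurj y)))).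
have eP y : isomorphism (e y) by exact: projT2 (cid (projT2 (cid (esurj y)))).
pose i y : chom (F (o y)) y := projT1 (cid (eP y)).
have [ie ei] : (forall y, ccomp (i y) (e y) = cidm y) /\
    (forall y, ccomp (e y) (i y) = cidm (F (o y))).
  by split=> y; have [] := projT2 (cid (eP y)).
pose G1 y z (h : chom y z) : chom (o y) (o z) :=
  projT1 (cid (full _ _ (ccomp (e z) (ccomp h (i y))))).
have GE y z h : fhom F (G1 y z h) = ccomp (e z) (ccomp h (i y)).
  exact: (projT2 (cid (full _ _ (ccomp (e z) (ccomp h (i y)))))).
have G1_id y : G1 y y (cidm y) = cidm (o y).
  by apply: faith; rewrite GE fhom_id ccomp1l ei.
have G1_comp x y z (g : chom y z) (f : chom x y) :
    G1 x z (ccomp g f) = ccomp (G1 y z g) (G1 x y f).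
  apply: faith; rewrite fhom_comp !GE -!ccompA; congr ccomp; congr ccomp.
  by rewrite (ccompA (i y)) ie ccomp1l.
pose G := CFunctor G1_id G1_comp.
exists F, G; split.
  (* The component at [x] is the preimage of the inverse of [e (F x)]; the preimage of [e (F x)]
     inverts it. *)
  pose eta x : chom (o (F x)) x := projT1 (cid (full _ _ (i (F x)))).
  have etaP x : fhom F (eta x) = i (F x).
    exact: projT2 (cid (full _ _ (i (F x)))).
  exists eta; split=> [x|x y f].
    have [g gP] := full _ _ (e (F x)).
    have ge : ccomp g (eta x) = cidm (o (F x)).
      by apply: faith; rewrite fhom_comp fhom_id etaP gP ei.
    have eg : ccomp (eta x) g = cidm x.
      by apply: faith; rewrite fhom_comp fhom_id etaP gP ie.
    by exists g.
  apply: faith; rewrite !fhom_comp /= GE !etaP ccompA.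
  by rewrite ie ccomp1l.
exists i; split=> [y|y z h]; last by rewrite /= GE ccompA ie ccomp1l.
by exists (e y); split; [exact: ei|exact: ie].
Qed.

Section Pullbacks.
Context {R : realType}.

Lemma bfun_comp (T U : Type) (p : T -> U) (f : U -> R) :
  fsa bfun_subalg f -> fsa bfun_subalg (f \o p).
Proof. by move=> [k fk]; exists k => x; exact: fk. Qed.

Lemma cfun_comp (X Y : topologicalType) (p : X -> Y) (f : Y -> R) :
  continuous p -> fsa cfun_subalg f -> fsa cfun_subalg (f \o p).
Proof.
move=> pc [fc fb]; split; last exact: bfun_comp.
by move=> x; apply: continuous_comp; [exact: pc|exact: fc].
Qed.

Definition bfun_pull (T U : Type) (p : T -> U) : bal_hom (@bfun R U) (bfun T) :=
  pullback (bfun_comp p).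

Definition cfun_pull (X Y : topologicalType) (p : X -> Y) (pc : continuous p) :
    bal_hom (@cfun R Y) (cfun X) :=
  pullback (fun f => cfun_comp pc).

Lemma bfun_pull_normal (T U : Type) (p : T -> U) : normal_hom (bfun_pull p).
Proof.
move=> S s Ss; split=> [_ [t St <-]|u uS].
  by apply: bal_hom_le; exact: Ss.1.
apply/fval_leP => x; apply: (fval_sup_le Ss) => t St.
by have /fval_leP/(_ x) := uS _ (ex_intro2 _ _ t St erefl).
Qed.

Lemma normal_hom_point (T U : Type) (s : bal_hom (@bfun R U) (bfun T)) :
  normal_hom s -> exists p : T -> U, forall f x, fval (s f) x = fval f (p x).
Proof.
move=> sn; suff /choice[p pP] x : exists y, fval (s (fpoint y)) x = 1.
  exists p => f x.
  (* The product of [f] with the indicator of [p x] is the scalar [f (p x)] times this indicator;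
     its image under [s] is evaluated at [x]. *)
  have /(congr1 (fun g : bfun T => fval g x)) := bal_homM s f (fpoint (p x)).
  by rewrite fpoint_mul bal_homZ fvalZ fvalM pP !mulr1.
apply: contrapT => /forallNP sx.
have S1 : supremums (range (@fpoint R U)) 1.
  split=> [_ [z _ <-]|u uS]; apply/fval_leP => y; rewrite fval1.
    by rewrite fpointE; case: asboolP.
  rewrite -(@fpointxx R _ y).
  by have /fval_leP/(_ y) := uS _ (ex_intro2 _ _ y Logic.I erefl).
suff : fval (s 1) x <= 0 by rewrite bal_hom1 fval1 ler10.
apply: fval_sup_le (sn _ _ S1) _ => _ [_ [y _ <-] <-].
have yy : idempotent_elt (s (fpoint y)).
  by rewrite /idempotent_elt -bal_homM fpoint_mul fpointxx scale1r.
by case: (bfun_idem x yy) => [->//|/sx].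
Qed.

End Pullbacks.

Section SpaceFunctor.
Variable R : realType.

Definition space_ext (X : creg_space) : basic_ext R :=
  BasicExt (@cfun_basic_extension R X (@creg_hausdorff X)
    (@creg_completely_regular X)).

Section Morphisms.
Variables (X Y : creg_space) (f : continuousType X Y).

Let fc : continuous f. Proof. exact: cts_fun. Qed.

Lemma space_square :
  bal_comp (@bfun_pull R _ _ f) (space_ext Y) =
  bal_comp (space_ext X) (cfun_pull fc).
Proof. by apply: bal_hom_eq => u; exact: fval_inj. Qed.

Definition space_hom : basic_hom (space_ext Y) (space_ext X) :=
  @BasicHom R (space_ext Y) (space_ext X) (cfun_pull fc) (bfun_pull f)
    (@bfun_pull_normal R _ _ f) space_square.

End Morphisms.

(** The square and the injectivity of the inclusion let [basic_sigma] determine [basic_rho]. *)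
Lemma space_hom_eq (X Y : creg_space)
    (g h : basic_hom (space_ext Y) (space_ext X)) :
  (forall u x, fval (basic_sigma g u) x = fval (basic_sigma h u) x) -> g = h.
Proof.
move=> gh; have sE : basic_sigma g = basic_sigma h.
  by apply: bal_hom_eq => u; exact: fval_inj.
apply: basic_hom_eq => //; apply: bal_hom_eq => u; apply: cfun_incl_inj.
have E (k : basic_hom (space_ext Y) (space_ext X)) :
    @cfun_incl R X (basic_rho k u) = basic_sigma k (@cfun_incl R Y u).
  exact: (congr1 (fun l : bal_hom (cfun Y) (bfun X) => l u)
    (esym (basic_square k))).
by rewrite !E sE.
Qed.

Definition space_lcbasic (X : LKHaus) : lcbasic R :=
  exist _ (space_ext (sval X))
    (conj (@cfun_maximal R (sval X : creg_space))
      (@cfun_locally_compact R (sval X : creg_space)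
        (@creg_completely_regular (sval X)) (proj2_sig X))).

Definition space_lcbasic_hom (X Y : opposite LKHaus) (f : chom X Y) :
  chom (space_lcbasic X) (space_lcbasic Y) := space_hom f.

Lemma space_lcbasic_id (X : opposite LKHaus) :
  space_lcbasic_hom (cidm X) = cidm (space_lcbasic X).
Proof. exact: space_hom_eq. Qed.

Lemma space_lcbasic_comp (X Y Z : opposite LKHaus) (g : chom Y Z)
    (f : chom X Y) :
  space_lcbasic_hom (ccomp g f) =
  ccomp (space_lcbasic_hom g) (space_lcbasic_hom f).
Proof. exact: space_hom_eq. Qed.

Definition space_functor : cfunctor (opposite LKHaus) (lcbasic R) :=
  CFunctor space_lcbasic_id space_lcbasic_comp.

Lemma space_functor_faithful (X Y : opposite LKHaus) (f g : chom X Y) :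
  fhom space_functor f = fhom space_functor g -> f = g.
Proof.
move=> fg; apply/continuousEP => x; apply/esym.
have : fval (basic_sigma (space_hom f) (fpoint (f x))) x =
       fval (basic_sigma (space_hom g) (fpoint (f x))) x.
  by rewrite (fg : space_hom f = space_hom g).
rewrite [LHS](_ : _ = fval (fpoint (f x)) (f x)) // fpointxx.
rewrite [RHS](_ : _ = fval (fpoint (f x)) (g x)) // fpointE.
by case: asboolP => // _ /eqP; rewrite oner_eq0.
Qed.

Lemma space_functor_full (X Y : opposite LKHaus)
    (h : chom (space_functor X) (space_functor Y)) :
  exists f, fhom space_functor f = h.
Proof.
pose X' : creg_space := sval X; pose Y' : creg_space := sval Y.
pose h' : basic_hom (space_ext X') (space_ext Y') := h.
have [p pP] := normal_hom_point (@basic_normal _ _ _ h').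
(* Take [u] equal to 1 at [p y] and 0 off [U]. The square identifies [u] composed with [p] with the
   continuous function [basic_rho h' u], whose cozero set is a neighbourhood of [y] mapped into
   [U]. *)
have pc : continuous (p : Y' -> X').
  apply/continuousP => U Uo; rewrite openE => y Uy.
  have [u [uy _ uU]] :=
    @cfun_separation R X' (@creg_completely_regular X') (p y) U Uo Uy.
  have uE z : fval (basic_rho h' u) z = fval u (p z).
    rewrite -(cfun_inclE u) -pP -cfun_inclE.
    exact: (congr1 (fun l : bal_hom (cfun X') (bfun Y') => fval (l u) z)
      (esym (basic_square h'))).
  have y0 : fval (basic_rho h' u) y <> 0.
    by rewrite uE uy; apply/eqP; rewrite oner_eq0.
  have := open_nbhs_nbhs (conj (cfun_open_neq0 (basic_rho h' u)) y0).
  by apply: filterS => z; rewrite /= uE => uz; apply: contrapT => /uU.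
exists (mkcts pc : chom X Y).
by apply: space_hom_eq => u x; rewrite pP.
Qed.

End SpaceFunctor.

(** * The space of a basic extension *)

Section PointSpace.
Context {R : realType} (alpha : basic_ext R).

Local Notation A := (ext_dom alpha).
Local Notation B := (ext_cod alpha).
Local Notation W := (initial_topology (flat alpha)).

Let Bb : basic_algebra B. Proof. by case: (ext_basic alpha). Qed.

Let alphaI : injective alpha.
Proof. by case: (ext_basic alpha) => /mono_injective. Qed.

(** Evaluation turns [B] into an algebra of functions on [W], the isolated points with the topology
    [tau alpha]. *)
Definition ptval (p : W) (b : B) : R :=
  residue (set_val (p : isolated_max B)) b.

Lemma ptval_inj (b c : B) : (forall p, ptval p b = ptval p c) -> b = c.
Proof. by move=> bc; apply: (basic_inj Bb) => p; exact: bc. Qed.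

Lemma ptval_surj (g : W -> R) (k : R) :
  (forall p, `|g p| <= k) -> exists b, forall p, ptval p b = g p.
Proof. exact: basic_surj. Qed.

Lemma ptval_openP (V : set W) : open V <->
  forall p, V p -> exists a, ptval p (alpha a) <> 0 /\
    forall q, ~ V q -> ptval q (alpha a) = 0.
Proof. exact: tauP. Qed.

Lemma open_ptval_neq0 a : open [set p : W | ptval p (alpha a) <> 0].
Proof. exact: tau_neq0. Qed.

Lemma ptval_continuous a : continuous (fun p : W => ptval p (alpha a)).
Proof.
apply: continuous_distP => p eps eps0; set r := ptval p (alpha a).
(* The cozero set of [alpha d] is exactly where [alpha a] is [eps]-close to its value at [p]. *)
pose d := Order.join (eps *: (1 : A) - labs (a - r *: (1 : A))) 0.
have dE q : ptval q (alpha d) = Num.max (eps - `|ptval q (alpha a) - r|) 0.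
  rewrite /ptval bal_hom_join bal_homB bal_hom_labs bal_homB !bal_homZ bal_hom1.
  by rewrite bal_hom0 residue_join !residueB residue_labs !residueE !mulr1.
have pd : ptval p (alpha d) <> 0.
  rewrite dE subrr normr0 subr0 max_l ?(ltW eps0) //.
  by apply/eqP; rewrite gt_eqF.
have := open_nbhs_nbhs (conj (open_ptval_neq0 d) pd).
apply: filterS => q /= qd; rewrite ltNge; apply/negP => qe.
by apply: qd; rewrite dE max_r // subr_le0.
Qed.

(** Joins and meets are pointwise, so if [p] and [q] agree on [A], the atom at [p], a join of meets
    from [A], is at most as large at [p] as at [q]. For distinct points this says [1 <= 0]. *)
Lemma ptval_separates (p q : W) :
  (forall a, ptval p (alpha a) = ptval q (alpha a)) -> p = q.
Proof.
move=> pq; have [_ _ dense] := ext_basic alpha.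
have [e eP] := atom_at (p : isolated_max B) Bb.
have meetE p' q' m T : (forall a, ptval p' (alpha a) = ptval q' (alpha a)) ->
    T `<=` range alpha -> infimums T m -> ptval p' m <= ptval q' m.
  move=> pq' Ta Tm; apply: (residue_inf_ge Bb Tm) => t Tt.
  have [a _ aE] := Ta t Tt; rewrite -aE -[leRHS]pq' aE.
  by apply: residue_le; exact: Tm.1.
have [S SP Se] := dense e.
have : ptval p e <= ptval q e.
  apply: (residue_sup_le Bb Se) => m Sm; have [T Ta Tm] := SP m Sm.
  apply: le_trans (meetE p q m T pq Ta Tm) _.
  by apply: residue_le; exact: Se.1.
rewrite /ptval !eP eqxx; have [->//|_] := eqVneq (q : isolated_max B) p.
by rewrite mulr1n mulr0n ler10.
Qed.

Lemma point_space_hausdorff : hausdorff_space W.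
Proof.
move=> p q pq; apply: ptval_separates => a; apply: (@Rhausdorff R).
move=> U V Up Vq.
have [r [rU rV]] :=
  pq _ _ (@ptval_continuous a p U Up) (@ptval_continuous a q V Vq).
by exists (ptval r (alpha a)).
Qed.

Lemma point_space_completely_regular : completely_regular_space W.
Proof.
move=> p C Cc Cp; apply/(@uniform_separatorP _ R).
have [a [pa aC]] := (ptval_openP _).1 (closed_openC Cc) p Cp.
(* Normalizing [|a|] by its value at [p] and truncating at 1 gives a function that is 0 at [p] and 1
   on [C]. *)
pose c := 1 - Order.meet (`|ptval p (alpha a)|^-1 *: labs a) 1.
have cE q : ptval q (alpha c) =
    1 - Num.min (`|ptval p (alpha a)|^-1 * `|ptval q (alpha a)|) 1.
  rewrite {1}/ptval bal_homB bal_hom_meet bal_homZ bal_hom_labs bal_hom1.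
  by rewrite residueB residue_meet residueZ residue_labs residue1.
exists (fun q => ptval q (alpha c)); split.
- exact: ptval_continuous.
- move=> _ [q _ <-]; rewrite /= in_itv /= cE.
  have : 0 <= `|ptval p (alpha a)|^-1 * `|ptval q (alpha a)|.
    by rewrite mulr_ge0.
  by move: (_ * _) => x; case_minmax; lra.
- move=> _ [_ -> <-] /=; rewrite cE mulVf ?minxx ?subrr //.
  by rewrite normr_eq0; exact/eqP.
- move=> _ [q Cq <-] /=; rewrite cE (aC q (fun nCq => nCq Cq)).
  by rewrite normr0 mulr0 min_l ?subr0.
Qed.

Definition point_space : creg_space :=
  CRegSpace point_space_hausdorff point_space_completely_regular.

Lemma ptval_fsa (b : B) : fsa (@bfun_subalg R W) (fun p => ptval p b).
Proof. by have [k bk] := residue_bounded b; exists k => p; exact: bk. Qed.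

Definition cod_rep : bal_hom B (bfun W) :=
  @representation R B W bfun_subalg (fun p : W => set_val (p : isolated_max B))
    ptval_fsa.

Lemma cod_repE b p : fval (cod_rep b) p = ptval p b. Proof. by []. Qed.

Lemma cod_rep_inj : injective cod_rep.
Proof. by move=> b c bc; apply: ptval_inj => p; rewrite -!cod_repE bc. Qed.

Lemma cod_rep_surj u : exists b, cod_rep b = u.
Proof.
have [k uk] := fvalP u; have [b bE] := ptval_surj uk.
by exists b; apply: fval_inj => p; rewrite cod_repE bE.
Qed.

Lemma residue_flat (p : isolated_max B) a :
  residue (flat alpha p) a = ptval p (alpha a).
Proof.
apply: residue_uniq; rewrite /= bal_homB bal_homZ bal_hom1; exact: residueP.
Qed.

Lemma flat_fsa a :
  fsa (@cfun_subalg R W) (fun p : W => residue (flat alpha p) a).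
Proof.
rewrite (_ : (fun p : W => _) = fun p : W => ptval p (alpha a)).
  by split; [exact: ptval_continuous|exact: ptval_fsa].
by apply/funext => p; exact: residue_flat.
Qed.

Definition dom_rep : bal_hom A (cfun W) := representation flat_fsa.

Lemma dom_repE a p : fval (dom_rep a) p = ptval p (alpha a).
Proof. exact: residue_flat. Qed.

Lemma dom_rep_inj : injective dom_rep.
Proof.
by move=> a b ab; apply/alphaI/ptval_inj => p; rewrite -!dom_repE ab.
Qed.

Lemma rep_square : bal_comp cod_rep alpha = bal_comp cfun_incl dom_rep.
Proof.
by apply: bal_hom_eq => a; apply: fval_inj => p; rewrite /= cfun_inclE dom_repE.
Qed.

(** The inclusion of [cfun W], transported into [B], is a basic extension compatible with [alpha]:
    it is dense because its image contains that of [alpha], and its cozero sets are open in [W].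
    Maximality then yields a section of [dom_rep]. *)
Lemma dom_rep_surj :
  maximal_extension alpha -> forall c, exists a, dom_rep a = c.
Proof.
move=> amax.
have [inv [repK invK]] := bal_hom_inverse cod_rep_inj cod_rep_surj.
have invE u p : ptval p (inv u) = fval u p.
  exact: (congr1 (fun h : bal_hom (bfun W) (bfun W) => fval (h u) p) repK).
pose gamma := bal_comp inv (@cfun_incl R W).
have gammaE c p : ptval p (gamma c) = fval c p by rewrite /= invE.
have gamma_dom a : gamma (dom_rep a) = alpha a.
  by apply: ptval_inj => p; rewrite gammaE dom_repE.
have gamma_basic : basic_extension gamma.
  split=> //.
    apply: injective_mono => c d cd; apply: fval_inj => p.
    by rewrite -!gammaE cd.
  have [_ _ dense] := ext_basic alpha.
  move=> b; have [S ST Sb] := dense b; exists S => // m Sm.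
  have [T Ta Tm] := ST m Sm; exists T => // t /Ta[a _ <-].
  by exists (dom_rep a).
have gamma_compatible : compatible alpha gamma.
  apply/seteqP; split=> V Vo; apply/tauP => p Vp.
    have [a [pa aV]] := (tauP alpha V).1 Vo p Vp; exists (dom_rep a).
    by rewrite gamma_dom.
  have [c [pc cV]] := (tauP gamma V).1 Vo p Vp.
  have := (@ptval_openP [set q | fval c q <> 0]).1 (cfun_open_neq0 c) p.
  case=> [|a [pa ac]]; first by rewrite /= -gammaE.
  exists a; split=> // q Vq; apply: ac => /=; apply.
  by rewrite -gammaE; exact: cV.
have [delta deltaE] := amax _ gamma gamma_basic gamma_compatible.
move=> c; exists (delta c); apply: fval_inj => p; rewrite dom_repE -gammaE.
by congr ptval; exact: (congr1 (fun h : bal_hom (cfun W) B => h c) deltaE).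
Qed.

(** A uniform bound strictly below [r] is what survives passage to the join of finitely many
    elements. *)
Lemma finite_lt_bound (T : Type) (S : set T) (g : T -> R) (r : R) :
  finite_set S -> (forall t, S t -> g t < r) ->
  exists2 m, m < r & forall t, S t -> g t <= m.
Proof.
elim/Pchoice: T => T in S g *.
move=> /finite_seqP[s ->]; elim: s => [|t s IHs] gr.
  by exists (r - 1); [rewrite ltrBlDr ltrDl|].
have [m mr gm] : exists2 m, m < r & forall u, [set` s] u -> g u <= m.
  by apply: IHs => u us; apply: gr; rewrite /= in_cons us orbT.
exists (Num.max (g t) m) => [|u /=].
  by rewrite gt_max mr andbT; apply: gr; rewrite /= mem_head.
rewrite in_cons => /orP[/eqP ->|us]; first by rewrite le_max lexx.
by rewrite le_max gm ?orbT.
Qed.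

(* The test family [T] consists of the truncated elements of [A] that are at
   least [r] only inside a single member of the cover, on the compact set. *)
Lemma compact_element_ge a (r : R) : 0 < r -> compact_element alpha a ->
  compact [set p : W | r <= `|ptval p (alpha a)|].
Proof.
move=> r0 ac; set K := [set p : W | _].
have Kclosed : open (~` K).
  rewrite (_ : ~` K = [set p | ptval p
      (alpha (Order.join (r *: (1 : A) - labs a) 0)) <> 0]).
    exact: open_ptval_neq0.
  have E p : ptval p (alpha (Order.join (r *: (1 : A) - labs a) 0)) =
      Num.max (r - `|ptval p (alpha a)|) 0.
    rewrite /ptval bal_hom_join bal_homB bal_homZ bal_hom_labs bal_hom1.
    rewrite bal_hom0 residue_join residueB residueZ residue_labs.
    by rewrite residue1 residue0 mulr1.
  apply/seteqP; split=> p /=; rewrite E.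
    by move=> /negP; rewrite -ltNge; case_minmax; lra.
  by move=> H; apply/negP; rewrite -ltNge; move: H; case_minmax; lra.
apply/compact_coverP => I D f fo Kf.
have [K0|/set0P[p0 Kp0]] := eqVneq K set0.
  by exists fset0 => //; rewrite K0.
have [i0 Di0 _] := Kf _ Kp0.
(* The join of [T] will be at least [k], hence at least [|a| + 1], so that compactness of [a]
   applies with [eps = 1]. *)
have [k k0 ak] := bal_le_scale1 (labs a + 1).
pose T := [set t : A | [/\ 0 <= t, t <= k *: (1 : A) &
  exists2 i, D i & forall p, K p -> ~ f i p -> ptval p (alpha t) < r]].
have test p : exists2 t, T t & ptval p (alpha t) = k.
  have [i Di [c [pc cK]]] : exists2 i, D i & exists c : A,
      ptval p (alpha c) <> 0 /\
      forall q, K q -> ~ f i q -> ptval q (alpha c) = 0.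
    (* Inside [K], a member of the cover contains [p]; outside, [c] can vanish on all of [K] and any
       index, such as [i0], will do. *)
    have [Kp|Kp] := pselect (K p).
      have [i Di fip] := Kf _ Kp; exists i => //.
      have [c [pc ci]] := (ptval_openP _).1 (fo i Di) p fip.
      by exists c; split=> // q _; exact: ci.
    exists i0 => //; have [c [pc cK]] := (ptval_openP _).1 Kclosed p Kp.
    by exists c; split=> // q Kq _; exact: (cK q (fun nKq => nKq Kq)).
  (* The scaling makes the value at [p] equal to [k], and the truncation keeps [t] below [k]. *)
  pose t : A :=
    Order.meet ((k / `|ptval p (alpha c)|) *: labs c) (k *: (1 : A)).
  have tE q : ptval q (alpha t) =
      Num.min (k / `|ptval p (alpha c)| * `|ptval q (alpha c)|) k.
    rewrite {1}/ptval bal_hom_meet !bal_homZ bal_hom_labs bal_hom1 residue_meet.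
    by rewrite !residueZ residue_labs residue1 mulr1.
  exists t; last by rewrite tE divfK ?minxx // normr_eq0; exact/eqP.
  split; [|exact: leIr|].
    rewrite lexI !l_scale_ge0 ?bal_ge01 ?l_abs_ge0 //.
    by rewrite divr_ge0.
  by exists i => // q Kq fq; rewrite tE (cK q Kq fq) normr0 mulr0 min_l.
have [t0 Tt0 _] := test p0.
have [||s sP] := Bb.1 (alpha @` T).
- by exists (alpha t0), t0.
- exists (alpha (k *: (1 : A))) => _ [t [_ tk _] <-]; exact: bal_hom_le.
have [||T' [s' [T'T T'f s'P as']]] := ac 1 T s ltr01 _ sP.
- by move=> t [].
- apply: (basic_leP Bb) => p; have [t Tt tp] := test p.
  rewrite scale1r -bal_hom_labs -(bal_hom1 alpha) -bal_homD.
  apply: le_trans (residue_le _ (bal_hom_le alpha ak)) _.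
  rewrite bal_homZ residueZ bal_hom1 residue1 mulr1 -tp.
  by apply: residue_le; apply: sP.1; exists t.
have /choice[g gP] (t : A) : exists i, T t -> D i /\
    forall p, K p -> ~ f i p -> ptval p (alpha t) < r.
  have [[_ _ [i Di iP]]|nT] := pselect (T t); first by exists i.
  by exists i0.
have /finite_fsetP[D' D'E] : finite_set (g @` T') by exact: finite_image.
exists D' => [i iD'|p Kp].
  have : [set` D'] i by [].
  by rewrite -D'E => -[t /T'T /gP[Di _] <-]; exact/mem_set.
(* At an uncovered [p] in [K] all members of [T'] are below [r], hence so is their join, although it
   dominates [|a|], which is at least [r] there. *)
apply: contrapT => nD'.
have [t T't|m mr T'm] :=
  @finite_lt_bound _ T' (fun t => ptval p (alpha t)) r T'f.
  apply: (gP t (T'T _ T't)).2 => // fp; apply: nD'; exists (g t) => //.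
  by rewrite -D'E; exists t.
have : ptval p s' <= m.
  by apply: (residue_sup_le Bb s'P) => _ [t T't <-]; exact: T'm.
have := residue_le (set_val (p : isolated_max B)) as'.
rewrite residue_labs; rewrite /K /= /ptval in Kp *; move: (residue _ s') => x.
by move: Kp mr; lra.
Qed.

Lemma point_space_locally_compact :
  locally_compact_extension alpha -> locally_compact [set: W].
Proof.
move=> alc p _.
have [a ac pa] : exists2 a, compact_element alpha a & 0 < ptval p (alpha a).
  (* Otherwise 1, as the join of the compact elements below it, would be at most 0 at [p]. *)
  apply: contrapT => na.
  have : ptval p (alpha 1) <= 0.
    apply: (residue_sup_le Bb (alc 1 (bal_ge01 A))) => _ [a [ac _] <-].
    by rewrite leNgt; apply/negP => pa; apply: na; exists a.
  by rewrite bal_hom1 /ptval residue1 ler10.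
pose r := ptval p (alpha a) / 2.
have r0 : 0 < r by rewrite divr_gt0.
have Kc := compact_element_ge r0 ac.
exists [set q : W | r <= `|ptval q (alpha a)|]; last first.
  by split=> //; exact: compact_closed point_space_hausdorff Kc.
rewrite withinET.
have /cvgrPdist_lt/(_ r r0) :
    (fun q : W => ptval q (alpha a)) @ p --> ptval p (alpha a)
  by exact: ptval_continuous.
apply: filterS => q /=; rewrite /r; have := ler_norm (ptval q (alpha a)).
by rewrite ltr_norml; lra.
Qed.

End PointSpace.

(** Both [cod_rep] and, by maximality, [dom_rep] are bijective, so they form an isomorphism onto the
    extension of the point space; normality holds in both directions by [surjective_normal]. *)
Lemma space_functor_esurj (R : realType) (alpha : lcbasic R) :
  exists (X : opposite LKHaus) (e : chom alpha (space_functor R X)),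
    isomorphism e.
Proof.
case: alpha => alpha [amax alc].
pose X : LKHaus :=
  exist _ (point_space alpha) (point_space_locally_compact alc).
exists X.
have rS := dom_rep_surj amax.
have [r [rr' r'r]] := bal_hom_inverse (@dom_rep_inj _ alpha) rS.
have [s [ss' s's]] :=
  bal_hom_inverse (@cod_rep_inj _ alpha) (@cod_rep_surj _ alpha).
have sn := surjective_normal (@cod_rep_inj _ alpha) (@cod_rep_surj _ alpha).
have srn : normal_hom s.
  apply: surjective_normal => [u v uv|b].
    have E w : cod_rep alpha (s w) = w.
      exact: (congr1 (fun h : bal_hom _ (bfun _) => h w) ss').
    by rewrite -(E u) uv E.
  exists (cod_rep alpha b).
  exact: (congr1 (fun h : bal_hom (ext_cod alpha) _ => h b) s's).
have sq : bal_comp s (space_ext R (point_space alpha)) = bal_comp alpha r.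
  apply: bal_hom_eq => u; have [a <-] := rS u.
  have -> : bal_comp alpha r (dom_rep alpha a) = alpha a.
    exact: (congr1 (fun h : bal_hom _ (ext_dom alpha) => alpha (h a)) r'r).
  transitivity (s (cod_rep alpha (alpha a))).
    exact: (congr1 (fun h : bal_hom (ext_dom alpha) (bfun _) => s (h a))
      (esym (rep_square alpha))).
  exact: (congr1 (fun h : bal_hom (ext_cod alpha) _ => h (alpha a)) s's).
pose e : basic_hom alpha (space_ext R (point_space alpha)) :=
  @BasicHom R alpha (space_ext R (point_space alpha)) (dom_rep alpha)
    (cod_rep alpha) sn (rep_square alpha).
pose e' : basic_hom (space_ext R (point_space alpha)) alpha :=
  @BasicHom R (space_ext R (point_space alpha)) alpha r s srn sq.
exists e, e'; split; exact: basic_hom_eq.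
Qed.

Theorem theorem5p21 (R : realType) : dually_equivalent LKHaus (lcbasic R).
Proof.
apply: (@fully_faithful_equivalent _ _ (space_functor R)).
- exact: space_functor_faithful.
- exact: space_functor_full.
- exact: space_functor_esurj.
Qed.
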